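(* Let $\mathcal{A}$ be an abelian category, let $T\in\mathcal{A}$ be a self-orthogonal object, and let $R=\mathrm{End}_{\mathcal{A}}(T)^{\mathrm{op}}$. Then the functor $\mathrm{Hom}_{\mathcal{A}}(T,-)$ restricts to a fully-faithful functor $\mathrm{Hom}_{\mathcal{A}}(T,-)\colon\alpha(T)\longrightarrow R\text{-}\mathrm{Gproj}$, and it induces a full embedding of triangulated categories (i.e. a fully-faithful triangle-functor) $\underline{\alpha(T)}\longrightarrow R\text{-}\underline{\mathrm{Gproj}}$.
   Context: For $X,Y\in\mathcal{A}$, $\mathrm{Ext}^n_{\mathcal{A}}(X,Y):=\mathrm{Hom}_{D^b(\mathcal{A})}(X,Y[n])$. A full additive subcategory $\omega\subseteq\mathcal{A}$ is self-orthogonal if $\mathrm{Ext}^n_{\mathcal{A}}(X,Y)=0$ for all $X,Y\in\omega$, $n\ge1$; an object $T$ is self-orthogonal if $\mathrm{add}\,T$ (the full subcategory of direct summands of finite direct sums of copies of $T$) is, i.e. $\mathrm{Ext}^n_{\mathcal{A}}(T,T)=0$ for all $n\ge 1$. For a self-orthogonal subcategory $\omega$ of an abelian category $\mathcal{A}$, let $\omega^\perp=\{X:\mathrm{Ext}^i_{\mathcal{A}}(W,X)=0\ \forall W\in\omega,\ i\ge1\}$ and ${}^\perp\omega=\{X:\mathrm{Ext}^i_{\mathcal{A}}(X,W)=0\ \forall W\in\omega,\ i\ge1\}$. Let ${}_\omega\mathcal{X}$ be the full subcategory of objects $X$ admitting an exact sequence $\cdots\to T^{-n}\xrightarrow{d^{-n}}T^{1-n}\to\cdots\to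 T^0\xrightarrow{d^0}X\to0$ with all $T^{-i}\in\omega$ and all $\mathrm{Ker}\,d^i\in\omega^\perp$, and $\mathcal{X}_\omega$ the full subcategory of objects $X$ admitting an exact sequence $0\to X\xrightarrow{d^{-1}}T^0\xrightarrow{d^0}T^1\to\cdots$ with all $T^i\in\omega$ and all $\mathrm{Coker}\,d^i\in{}^\perp\omega$. The category of $\omega$-Cohen-Macaulay objects is $\alpha(\omega):=\mathcal{X}_\omega\cap{}_\omega\mathcal{X}$; it is a Frobenius exact category (conflations: short exact sequences of $\mathcal{A}$ with terms in $\alpha(\omega)$) whose projective-injective objects are those of $\mathrm{add}\,\omega$. Its stable category $\underline{\alpha(\omega)}$ (morphisms modulo those factoring through $\omega$) is triangulated in the usual way. Put $\alpha(T):=\alpha(\mathrm{add}\,T)$ and $\underline{\alpha(T)}$ its stable category. For a ring $R$, $R\text{-}\mathrm{Mod}$ is the category of left $R$-modules, $R\text{-}\mathrm{proj}$ the full subcategory of finitely generated projective modules, and $R\text{-}\mathrm{Gproj}:=\alpha(R\text{-}\mathrm{proj})$ formed in the abelian category $R\text{-}\mathrm{Mod}$, with stable category $R\text{-}\underline{\mathrm{Gproj}}$. Explicitly, $M\in R\text{-}\mathrm{Gproj}$ iff $M$ has a (possibly infinite) resolution by finitely generated projectives and there is an exact sequence $0\to M\xrightarrow{d^{-1}}P^0\xrightarrow{d^0}P^1\to\cdots$ with $P^n\in R\text{-}\mathrm{proj}$ and all $\mathrm{Coker}\,d^n\in{}^\perp(R\text{-}\mathrm{proj})$. With $R=\mathrm{End}_{\mathcal{A}}(T)^{\mathrm{op}}$,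 the functor $\mathrm{Hom}_{\mathcal{A}}(T,-)$ takes values in $R\text{-}\mathrm{Mod}$. *)

(* Defs.v *)
From HB Require Import structures.
From mathcomp Require Import all_boot all_order all_algebra boolp.

Set Implicit Arguments.
Unset Strict Implicit.
Unset Printing Implicit Defensive.

Import GRing.Theory.
Local Open Scope ring_scope.

Reserved Notation "g ∘ f" (at level 40, left associativity).

(* A chosen zero object is part of the data; it is only used to write down
   complexes concentrated in one degree. *)
Record preadditive := Preadditive {
  obj :> Type;
  hom : obj -> obj -> zmodType;
  idm : forall X, hom X X;
  comp : forall X Y Z, hom Y Z -> hom X Y -> hom X Z;
  zob : obj;
  compA : forall X Y Z W (h : hom Z W) (g : hom Y Z) (f : hom X Y),
    comp h (comp g f) = comp (comp h g) f;
  comp1m : forall X Y (f : hom X Y), comp (idm Y) f = f;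
  compm1 : forall X Y (f : hom X Y), comp f (idm X) = f;
  compDl : forall X Y Z (g g' : hom Y Z) (f : hom X Y),
    comp (g + g') f = comp g f + comp g' f;
  compDr : forall X Y Z (g : hom Y Z) (f f' : hom X Y),
    comp g (f + f') = comp g f + comp g f';
  zobP : idm zob = 0
}.

Arguments hom {p} X Y.
Arguments idm {p} X.
Arguments comp {p X Y Z} g f.
Arguments zob {p}.
Notation "g ∘ f" := (comp g f).

Record functor (C D : preadditive) := Functor {
  fobj :> C -> D;
  fmap : forall X Y : C, hom X Y -> hom (fobj X) (fobj Y);
  fmap1 : forall X : C, fmap (idm X) = idm (fobj X);
  fmapM : forall (X Y Z : C) (g : hom Y Z) (f : hom X Y),
    fmap (g ∘ f) = fmap g ∘ fmap f;
  fmapD : forall (X Y : C) (f g : hom X Y), fmap (f + g) = fmap f + fmap g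
}.

Arguments fmap {C D} F {X Y} f : rename.

Section PreadditiveTheory.
Variable C : preadditive.

Lemma comp0m (X Y Z : C) (f : hom X Y) : (0 : hom Y Z) ∘ f = 0.
Proof. by apply: (addrI (0 ∘ f)); rewrite -compDl !addr0. Qed.

Lemma compm0 (X Y Z : C) (g : hom Y Z) : g ∘ (0 : hom X Y) = 0.
Proof. by apply: (addrI (g ∘ 0)); rewrite -compDr !addr0. Qed.

Lemma compNm (X Y Z : C) (g : hom Y Z) (f : hom X Y) : (- g) ∘ f = - (g ∘ f).
Proof. by apply: (addrI (g ∘ f)); rewrite -compDl !subrr comp0m. Qed.

Lemma compmN (X Y Z : C) (g : hom Y Z) (f : hom X Y) : g ∘ (- f) = - (g ∘ f).
Proof. by apply: (addrI (g ∘ f)); rewrite -compDr !subrr compm0. Qed.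

Definition mono (X Y : C) (f : hom X Y) :=
  forall (W : C) (a b : hom W X), f ∘ a = f ∘ b -> a = b.

Definition epi (X Y : C) (f : hom X Y) :=
  forall (W : C) (a b : hom Y W), a ∘ f = b ∘ f -> a = b.

Definition is_iso (X Y : C) (f : hom X Y) :=
  exists g : hom Y X, g ∘ f = idm X /\ f ∘ g = idm Y.

Definition is_kernel (X Y K : C) (f : hom X Y) (k : hom K X) :=
  f ∘ k = 0 /\
  forall (W : C) (h : hom W X), f ∘ h = 0 -> exists! u : hom W K, k ∘ u = h.

Definition is_coker (X Y Q : C) (f : hom X Y) (q : hom Y Q) :=
  q ∘ f = 0 /\
  forall (W : C) (h : hom Y W), h ∘ f = 0 -> exists! u : hom Q W, u ∘ q = h.

Definition is_image (X Y I : C) (f : hom X Y) (i : hom I Y) :=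
  exists (Q : C) (q : hom Y Q), is_coker f q /\ is_kernel q i.

Definition is_biproduct (X Y S : C)
    (i : hom X S) (j : hom Y S) (p : hom S X) (q : hom S Y) :=
  [/\ p ∘ i = idm X, q ∘ j = idm Y, p ∘ j = 0, q ∘ i = 0
    & i ∘ p + j ∘ q = idm S].

Definition abelian_category :=
  [/\ forall X Y : C, exists (S : C) (i : hom X S) (j : hom Y S)
        (p : hom S X) (q : hom S Y), is_biproduct i j p q,
      forall (X Y : C) (f : hom X Y), exists (K : C) (k : hom K X),
        is_kernel f k,
      forall (X Y : C) (f : hom X Y), exists (Q : C) (q : hom Y Q),
        is_coker f q,
      forall (X Y : C) (f : hom X Y), mono f ->
        exists (Z : C) (g : hom Y Z), is_kernel g f
    & forall (X Y : C) (f : hom X Y), epi f ->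
        exists (Z : C) (g : hom Z X), is_coker g f].

Definition exact_at (X Y Z : C) (f : hom X Y) (g : hom Y Z) :=
  exists (I : C) (i : hom I Y), is_image f i /\ is_kernel g i.

Definition short_exact (X Y Z : C) (f : hom X Y) (g : hom Y Z) :=
  is_kernel g f /\ is_coker f g.

Definition is_pushout (X Y Z S : C) (f : hom X Y) (g : hom X Z)
    (f' : hom Z S) (g' : hom Y S) :=
  g' ∘ f = f' ∘ g /\
  forall (W : C) (a : hom Y W) (b : hom Z W), a ∘ f = b ∘ g ->
    exists! u : hom S W, u ∘ g' = a /\ u ∘ f' = b.

(* The differential is a matrix of morphisms supported on j = i + 1, so that
   no transport along equalities between degrees is ever needed. *)
Record complex := Complex {
  cobj :> int -> C;
  cdiff : forall i j, hom (cobj i) (cobj j);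
  cdiff_shape : forall i j, j != i + 1 -> cdiff i j = 0;
  cdiff2 : forall i j k, cdiff j k ∘ cdiff i j = 0
}.

Definition bounded (X : complex) :=
  exists N : nat, forall i : int, (N < `|i|)%N -> idm (X i) = 0.

Record cmap (X Y : complex) := CMap {
  cmor :> forall i, hom (X i) (Y i);
  cmorC : forall i j, cmor j ∘ cdiff X i j = cdiff Y i j ∘ cmor i
}.

Lemma cmap_id_subproof (X : complex) i j :
  idm (X j) ∘ cdiff X i j = cdiff X i j ∘ idm (X i).
Proof. by rewrite comp1m compm1. Qed.

Definition cmap_id (X : complex) : cmap X X := CMap (@cmap_id_subproof X).

Lemma cmap_zero_subproof (X Y : complex) i j :
  (0 : hom (X j) (Y j)) ∘ cdiff X i j = cdiff Y i j ∘ (0 : hom (X i) (Y i)).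
Proof. by rewrite comp0m compm0. Qed.

Definition cmap_zero (X Y : complex) : cmap X Y :=
  CMap (@cmap_zero_subproof X Y).

Lemma cmap_comp_subproof (X Y Z : complex) (g : cmap Y Z) (f : cmap X Y) i j :
  (g j ∘ f j) ∘ cdiff X i j = cdiff Z i j ∘ (g i ∘ f i).
Proof. by rewrite -compA cmorC compA cmorC compA. Qed.

Definition cmap_comp (X Y Z : complex) (g : cmap Y Z) (f : cmap X Y) :
  cmap X Z := CMap (cmap_comp_subproof g f).

Definition homotopic (X Y : complex) (f g : cmap X Y) :=
  exists h : forall i j, hom (X i) (Y j), forall i : int,
    f i - g i = cdiff Y (i - 1) i ∘ h i (i - 1) + h (i + 1) i ∘ cdiff X i (i + 1).

(* H, with the cocycles k : K -> X^i and the projection p : K -> H, is the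
   cohomology of X in degree i. *)
Definition is_cohomology (X : complex) (i : int) (K H : C)
    (k : hom K (X i)) (p : hom K H) :=
  is_kernel (cdiff X i (i + 1)) k /\
  exists b : hom (X (i - 1)) K, k ∘ b = cdiff X (i - 1) i /\ is_coker b p.

(* h ranges over the morphisms induced by f in cohomology. *)
Definition quasi_iso (X Y : complex) (f : cmap X Y) :=
  forall (i : int) (K H K' H' : C) (k : hom K (X i)) (p : hom K H)
    (k' : hom K' (Y i)) (p' : hom K' H') (u : hom K K') (h : hom H H'),
    is_cohomology k p -> is_cohomology k' p' ->
    k' ∘ u = f i ∘ k -> h ∘ p = p' ∘ u -> is_iso h.

Lemma is_coker_epi (X Y Q : C) (f : hom X Y) (q : hom Y Q) :
  is_coker f q -> epi q.
Proof.
move=> [qf0 univ] W a b eab.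
have [|u [_ uniq_u]] := univ W (b ∘ q); first by rewrite -compA qf0 compm0.
by rewrite -(uniq_u a eab) -(uniq_u b erefl).
Qed.

Lemma is_kernel_mono (X Y K : C) (f : hom X Y) (k : hom K X) :
  is_kernel f k -> mono k.
Proof.
move=> [fk0 univ] W a b eab.
have [|u [_ uniq_u]] := univ W (k ∘ b); first by rewrite compA fk0 comp0m.
by rewrite -(uniq_u a eab) -(uniq_u b erefl).
Qed.

Lemma quasi_iso_id (X : complex) : quasi_iso (cmap_id X).
Proof.
move=> i K H K' H' k p k' p' u h [kerk [b [kb cokp]]] [kerk' [b' [kb' cokp']]].
rewrite /= comp1m => k'u hp.
have mk := is_kernel_mono kerk; have mk' := is_kernel_mono kerk'.
have [v [kv _]] := kerk.2 _ k' kerk'.1.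
have vu : v ∘ u = idm K by apply: mk; rewrite compA kv k'u compm1.
have uv : u ∘ v = idm K' by apply: mk'; rewrite compA k'u kv compm1.
have vb' : v ∘ b' = b by apply: mk; rewrite compA kv kb' kb.
have [|g [gp' _]] := cokp'.2 _ (p ∘ v); first by rewrite -compA vb' cokp.1.
exists g; split.
  apply: (is_coker_epi cokp).
  by rewrite -compA hp compA gp' -compA vu compm1 comp1m.
apply: (is_coker_epi cokp').
by rewrite -compA gp' compA hp -compA uv compm1 comp1m.
Qed.

(* Morphisms X -> Y of the bounded derived category are represented by roofs
   X <~ Z -> Y with Z bounded, up to the equivalence [roof_eq]. *)
Record roof (X Y : complex) := Roof {
  apex : complex;
  apex_bounded : bounded apex;
  back : cmap apex X;
  back_qis : quasi_iso back;
  forth : cmap apex Y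
}.

Definition roof_eq (X Y : complex) (r r' : roof X Y) :=
  exists (W : complex) (t : cmap W (apex r)) (t' : cmap W (apex r')),
    [/\ bounded W,
        quasi_iso (cmap_comp (back r) t),
        homotopic (cmap_comp (back r) t) (cmap_comp (back r') t')
      & homotopic (cmap_comp (forth r) t) (cmap_comp (forth r') t')].

Definition roof_zero (X Y : complex) (bX : bounded X) : roof X Y :=
  Roof bX (@quasi_iso_id X) (cmap_zero X Y).

Definition stalk_obj (X : C) (i : int) : C := if i == 0 then X else zob.

Lemma stalk_diff2 (X : C) i j k :
  (0 : hom (stalk_obj X j) (stalk_obj X k)) ∘
  (0 : hom (stalk_obj X i) (stalk_obj X j)) = 0.
Proof. by rewrite comp0m. Qed.

Definition stalk (X : C) : complex :=
  @Complex (stalk_obj X) (fun i j => 0) (fun i j _ => erefl) (@stalk_diff2 X).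

Lemma stalk_bounded (X : C) : bounded (stalk X).
Proof. by exists 0%N; case=> [[|n]|n] //= _; rewrite zobP. Qed.

Definition shift_diff (n : nat) (X : complex) (i j : int) :
    hom (X (i + n%:Z)) (X (j + n%:Z)) :=
  if odd n then - cdiff X (i + n%:Z) (j + n%:Z)
  else cdiff X (i + n%:Z) (j + n%:Z).

Lemma shift_shape n X i j : j != i + 1 -> shift_diff n X i j = 0.
Proof.
move=> ne; rewrite /shift_diff cdiff_shape ?oppr0 ?if_same //.
by rewrite addrAC (inj_eq (addIr _)).
Qed.

Lemma shift_diff2 n X i j k : shift_diff n X j k ∘ shift_diff n X i j = 0.
Proof.
by rewrite /shift_diff; case: odd; rewrite ?compNm ?compmN cdiff2 ?oppr0.
Qed.

Definition shift (n : nat) (X : complex) : complex :=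
  Complex (@shift_shape n X) (@shift_diff2 n X).

(* Ext^n(X, Y) = Hom_{D^b}(X, Y[n]) is zero. *)
Definition Ext_vanishes (n : nat) (X Y : C) :=
  forall r : roof (stalk X) (shift n (stalk Y)),
    roof_eq r (roof_zero _ (stalk_bounded X)).

(* Full subcategories are given by predicates on objects. *)

Definition self_orthogonal (omega : C -> Prop) :=
  forall X Y : C, omega X -> omega Y ->
  forall n : nat, (1 <= n)%N -> Ext_vanishes n X Y.

Definition is_copower (T : C) (n : nat) (S : C)
    (i : 'I_n -> hom T S) (p : 'I_n -> hom S T) :=
  (forall a b, p a ∘ i b = if a == b then idm T else 0) /\
  \sum_(a < n) i a ∘ p a = idm S.

Definition add_subcat (T : C) (X : C) :=
  exists (n : nat) (S : C) (i : 'I_n -> hom T S) (p : 'I_n -> hom S T),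
    is_copower i p /\
    exists (Y : C) (a : hom X S) (b : hom Y S) (c : hom S X) (d : hom S Y),
      is_biproduct a b c d.

Definition self_orthogonal_object (T : C) := self_orthogonal (add_subcat T).

Definition right_perp (omega : C -> Prop) (X : C) :=
  forall W : C, omega W -> forall n : nat, (1 <= n)%N -> Ext_vanishes n W X.

Definition left_perp (omega : C -> Prop) (X : C) :=
  forall W : C, omega W -> forall n : nat, (1 <= n)%N -> Ext_vanishes n X W.

Definition kernel_in (P : C -> Prop) (X Y : C) (f : hom X Y) :=
  exists (K : C) (k : hom K X), is_kernel f k /\ P K.

Definition coker_in (P : C -> Prop) (X Y : C) (f : hom X Y) :=
  exists (Q : C) (q : hom Y Q), is_coker f q /\ P Q.

(* ... -> T 1 -> T 0 -> X -> 0 *)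
Definition has_resolution (omega : C -> Prop) (X : C) :=
  exists (T : nat -> C) (d : forall n, hom (T n.+1) (T n)) (e : hom (T 0%N) X),
    [/\ forall n, omega (T n),
        epi e,
        exact_at (d 0%N) e,
        forall n, exact_at (d n.+1) (d n)
      & kernel_in (right_perp omega) e /\
        forall n, kernel_in (right_perp omega) (d n)].

(* 0 -> X -> T 0 -> T 1 -> ... *)
Definition has_coresolution (omega : C -> Prop) (X : C) :=
  exists (T : nat -> C) (d : forall n, hom (T n) (T n.+1)) (e : hom X (T 0%N)),
    [/\ forall n, omega (T n),
        mono e,
        exact_at e (d 0%N),
        forall n, exact_at (d n) (d n.+1)
      & coker_in (left_perp omega) e /\
        forall n, coker_in (left_perp omega) (d n)].

(* The category alpha(omega) of omega-Cohen-Macaulay objects. *)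
Definition CM (omega : C -> Prop) (X : C) :=
  has_coresolution omega X /\ has_resolution omega X.

Variable omega : C -> Prop.

(* The objects of the stable category are those of alpha(omega), its morphisms
   are morphisms of C modulo [stable_eq]. *)
Definition stable_eq (X Y : C) (f g : hom X Y) :=
  exists (W : C) (a : hom X W) (b : hom W Y), omega W /\ f - g = b ∘ a.

Definition stable_iso (X Y : C) (f : hom X Y) :=
  exists g : hom Y X,
    stable_eq (g ∘ f) (idm X) /\ stable_eq (f ∘ g) (idm Y).

Definition conflation (X Y Z : C) (f : hom X Y) (g : hom Y Z) :=
  [/\ CM omega X, CM omega Y, CM omega Z & short_exact f g].

(* A choice, for every X in alpha(omega), of a conflation
   X -> I X -> Sigma X with I X injective; values outside alpha(omega) are
   irrelevant. *)
Record suspension := Suspension {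
  inj_obj : C -> C;
  susp : C -> C;
  inj_in : forall X, hom X (inj_obj X);
  susp_proj : forall X, hom (inj_obj X) (susp X);
  inj_objP : forall X, CM omega X -> omega (inj_obj X);
  susp_conflation : forall X, CM omega X ->
    conflation (inj_in X) (susp_proj X)
}.

Variable S : suspension.

(* f' represents the value of the suspension functor at the class of f. *)
Definition susp_mor (X Y : C) (f : hom X Y) (f' : hom (susp S X) (susp S Y)) :=
  exists h : hom (inj_obj S X) (inj_obj S Y),
    h ∘ inj_in S X = inj_in S Y ∘ f /\ f' ∘ susp_proj S X = susp_proj S Y ∘ h.

(*     X --> I X --> Sigma X
       |u     |u'      ||
       v      v        ||
       Y --> Z -----> Sigma X      (the left-hand square is a pushout)
          v     w                                                             *)
Definition standard_triangle (X Y Z : C)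
    (u : hom X Y) (v : hom Y Z) (w : hom Z (susp S X)) :=
  [/\ CM omega X, CM omega Y, CM omega Z
    & exists u' : hom (inj_obj S X) Z,
        [/\ is_pushout (inj_in S X) u v u',
            w ∘ u' = susp_proj S X & w ∘ v = 0]].

Definition distinguished (X Y Z : C)
    (u : hom X Y) (v : hom Y Z) (w : hom Z (susp S X)) :=
  [/\ CM omega X, CM omega Y, CM omega Z
    & exists (X' Y' Z' : C)
        (u' : hom X' Y') (v' : hom Y' Z') (w' : hom Z' (susp S X')),
        standard_triangle u' v' w' /\
        exists (a : hom X X') (b : hom Y Y') (c : hom Z Z')
          (a' : hom (susp S X) (susp S X')),
          [/\ stable_iso a /\ stable_iso b /\ stable_iso c,
              susp_mor a a',
              stable_eq (b ∘ u) (u' ∘ a),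
              stable_eq (c ∘ v) (v' ∘ b)
            & stable_eq (a' ∘ w) (w' ∘ c)]].

End PreadditiveTheory.

Section Functors.
Variables (C D : preadditive) (F : functor C D).

Definition restricts_to (P : C -> Prop) (Q : D -> Prop) :=
  forall X : C, P X -> Q (F X).

Definition fully_faithful_on (P : C -> Prop) :=
  forall X Y : C, P X -> P Y ->
    bijective (fmap F : hom X Y -> hom (F X) (F Y)).

Variables (omega : C -> Prop) (omega' : D -> Prop).

Definition stably_well_defined :=
  forall (X Y : C) (f g : hom X Y), CM omega X -> CM omega Y ->
    stable_eq omega f g -> stable_eq omega' (fmap F f) (fmap F g).

Definition stably_faithful :=
  forall (X Y : C) (f g : hom X Y), CM omega X -> CM omega Y ->
    stable_eq omega' (fmap F f) (fmap F g) -> stable_eq omega f g.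

Definition stably_full :=
  forall (X Y : C) (g : hom (F X) (F Y)), CM omega X -> CM omega Y ->
    exists f : hom X Y, stable_eq omega' (fmap F f) g.

(* The functor induced by F on stable categories, together with a natural
   isomorphism phi : F Sigma -> Sigma' F, preserves distinguished triangles. *)
Definition stable_triangle_functor
    (S : suspension omega) (S' : suspension omega') :=
  exists phi : forall X : C, hom (F (susp S X)) (susp S' (F X)),
    [/\ forall X : C, CM omega X -> stable_iso omega' (phi X),
        forall (X Y : C) (f : hom X Y) (f' : hom (susp S X) (susp S Y))
          (g : hom (susp S' (F X)) (susp S' (F Y))),
          CM omega X -> CM omega Y -> susp_mor f f' -> susp_mor (fmap F f) g ->
          stable_eq omega' (phi Y ∘ fmap F f') (g ∘ phi X)
      & forall (X Y Z : C)
          (u : hom X Y) (v : hom Y Z) (w : hom Z (susp S X)),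
          distinguished u v w ->
          distinguished (fmap F u) (fmap F v) (phi X ∘ fmap F w)].

(* The suspension depends on a choice, which is unique up to canonical
   isomorphism: such choices exist for both stable categories, and any of them
   may be used. *)
Definition induces_full_triangulated_embedding :=
  [/\ restricts_to (CM omega) (CM omega'),
      stably_well_defined,
      stably_faithful /\ stably_full,
      inhabited (suspension omega) /\ inhabited (suspension omega')
    & forall (S : suspension omega) (S' : suspension omega'),
        stable_triangle_functor S S'].

End Functors.

Section LinearMaps.
Variables (R : pzRingType) (M N : lmodType R).

Definition lin_hom := {linear M -> N}.

HB.instance Definition _ := gen_eqMixin lin_hom.
HB.instance Definition _ := gen_choiceMixin lin_hom.

Lemma lin_homP (f g : lin_hom) : f =1 g -> f = g.
Proof.
case: f g => [f cf] [g cg] /= /funext e; case: _ / e in cg *.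
case: cf cg => [[fD] [fZ]] [[gD] [gZ]].
by rewrite (Prop_irrelevance fD gD) (Prop_irrelevance fZ gZ).
Qed.

Definition lin_add (f g : lin_hom) : lin_hom :=
  (f : {linear M -> N}) \+ (g : {linear M -> N}).
Definition lin_opp (f : lin_hom) : lin_hom := \- (f : {linear M -> N}).
Definition lin_zero : lin_hom := \0 : M -> N.

Lemma lin_addA : associative lin_add.
Proof. by move=> f g h; apply: lin_homP => x /=; rewrite addrA. Qed.

Lemma lin_addC : commutative lin_add.
Proof. by move=> f g; apply: lin_homP => x /=; rewrite addrC. Qed.

Lemma lin_add0 : left_id lin_zero lin_add.
Proof. by move=> f; apply: lin_homP => x /=; rewrite add0r. Qed.

Lemma lin_addN : left_inverse lin_zero lin_opp lin_add.
Proof. by move=> f; apply: lin_homP => x /=; rewrite addNr. Qed.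

HB.instance Definition _ :=
  GRing.isZmodule.Build lin_hom lin_addA lin_addC lin_add0 lin_addN.

End LinearMaps.

Section LModCategory.
Variable R : pzRingType.

Definition lin_id (M : lmodType R) : lin_hom M M := @idfun M.

Definition lin_comp (M N P : lmodType R) (g : lin_hom N P) (f : lin_hom M N) :
  lin_hom M P := (g : {linear N -> P}) \o (f : {linear M -> N}).

Lemma lin_compA (M N P Q : lmodType R)
    (h : lin_hom P Q) (g : lin_hom N P) (f : lin_hom M N) :
  lin_comp h (lin_comp g f) = lin_comp (lin_comp h g) f.
Proof. exact: lin_homP. Qed.

Lemma lin_comp1m (M N : lmodType R) (f : lin_hom M N) :
  lin_comp (lin_id N) f = f.
Proof. exact: lin_homP. Qed.

Lemma lin_compm1 (M N : lmodType R) (f : lin_hom M N) :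
  lin_comp f (lin_id M) = f.
Proof. exact: lin_homP. Qed.

Lemma lin_compDl (M N P : lmodType R) (g g' : lin_hom N P) (f : lin_hom M N) :
  lin_comp (g + g') f = lin_comp g f + lin_comp g' f.
Proof. exact: lin_homP. Qed.

Lemma lin_compDr (M N P : lmodType R) (g : lin_hom N P) (f f' : lin_hom M N) :
  lin_comp g (f + f') = lin_comp g f + lin_comp g f'.
Proof. by apply: lin_homP => x /=; rewrite linearD. Qed.

Lemma lin_id0 : lin_id 'rV[R]_0 = 0.
Proof. by apply: lin_homP => x; rewrite [LHS]thinmx0 [RHS]thinmx0. Qed.

Definition LMod : preadditive :=
  @Preadditive (lmodType R) (fun M N => lin_hom M N) lin_id lin_comp 'rV[R]_0
    lin_compA lin_comp1m lin_compm1 lin_compDl lin_compDr lin_id0.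

Definition finitely_generated (M : lmodType R) :=
  exists (n : nat) (e : 'I_n -> M), forall m : M,
    exists c : 'I_n -> R, m = \sum_(i < n) c i *: e i.

Definition projective_module (M : lmodType R) :=
  forall (N N' : lmodType R) (g : {linear N -> N'}),
    (forall y, exists x, g x = y) ->
    forall f : {linear M -> N'}, exists h : {linear M -> N}, g \o h =1 f.

Definition fgproj (M : LMod) := finitely_generated M /\ projective_module M.

Definition Gproj : LMod -> Prop := CM fgproj.

End LModCategory.

Section HomFunctor.
Variables (C : preadditive) (T : C).

Definition endo := hom T T : Type.
HB.instance Definition _ := GRing.Zmodule.on endo.

Lemma endo_mulA : associative (fun g f : endo => g ∘ f : endo).
Proof. by move=> h g f; rewrite compA. Qed.

Lemma endo_mul1 : left_id (idm T : endo) (fun g f : endo => g ∘ f).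
Proof. by move=> f; rewrite comp1m. Qed.

Lemma endo_mulr1 : right_id (idm T : endo) (fun g f : endo => g ∘ f).
Proof. by move=> f; rewrite compm1. Qed.

Lemma endo_mulDl : left_distributive (fun g f : endo => g ∘ f : endo) +%R.
Proof. by move=> g g' f; apply: compDl. Qed.

Lemma endo_mulDr : right_distributive (fun g f : endo => g ∘ f : endo) +%R.
Proof. by move=> g f f'; apply: compDr. Qed.

HB.instance Definition _ := GRing.Zmodule_isPzRing.Build endo
  endo_mulA endo_mul1 endo_mulr1 endo_mulDl endo_mulDr.

Definition endo_op : pzRingType := endo^c.

Definition hom_from (X : C) := hom T X : Type.
HB.instance Definition _ X := GRing.Zmodule.on (hom_from X).

(* endo_op is the converse of End(T), in which the product is composition, so
   precomposition is a left action. *)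
Definition hom_scale X (r : endo_op) (x : hom_from X) : hom_from X :=
  (x : hom T X) ∘ (r : hom T T).

Lemma hom_scaleA X (a b : endo_op) (x : hom_from X) :
  hom_scale a (hom_scale b x) = hom_scale (a * b) x.
Proof. by rewrite /hom_scale -compA. Qed.

Lemma hom_scale1 X : left_id 1 (@hom_scale X).
Proof. by move=> x; apply: compm1. Qed.

Lemma hom_scaleDr X : right_distributive (@hom_scale X) +%R.
Proof. by move=> a x y; apply: compDl. Qed.

Lemma hom_scaleDl X (x : hom_from X) :
  {morph (@hom_scale X)^~ x : a b / a + b}.
Proof. by move=> a b; apply: compDr. Qed.

HB.instance Definition _ X := GRing.Zmodule_isLmodule.Build endo_op (hom_from X)
  (@hom_scaleA X) (@hom_scale1 X) (@hom_scaleDr X) (@hom_scaleDl X).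

Section PostComposition.
Variables (X Y : C) (f : hom X Y).

Definition postcomp (x : hom_from X) : hom_from Y := f ∘ (x : hom T X).

Lemma postcomp_linear : linear postcomp.
Proof.
move=> a x y; rewrite /postcomp compDr; congr (_ + _).
exact: compA.
Qed.

HB.instance Definition _ :=
  GRing.isLinear.Build endo_op (hom_from X) (hom_from Y) _ postcomp
    postcomp_linear.

End PostComposition.

Definition postcomp_lin X Y (f : hom X Y) :
  hom (hom_from X : LMod endo_op) (hom_from Y : LMod endo_op) :=
  (postcomp f : {linear hom_from X -> hom_from Y}).

Lemma postcomp_lin1 X : postcomp_lin (idm X) = idm _.
Proof. by apply: lin_homP => x; apply: comp1m. Qed.

Lemma postcomp_linM X Y Z (g : hom Y Z) (f : hom X Y) :
  postcomp_lin (g ∘ f) = postcomp_lin g ∘ postcomp_lin f.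
Proof. by apply: lin_homP => x; rewrite /= /postcomp -compA. Qed.

Lemma postcomp_linD X Y (f g : hom X Y) :
  postcomp_lin (f + g) = postcomp_lin f + postcomp_lin g.
Proof. by apply: lin_homP => x; apply: compDl. Qed.

Definition Hom_functor : functor C (LMod endo_op) :=
  Functor postcomp_lin1 postcomp_linM postcomp_linD.

End HomFunctor.

(* Main.v *)
From HB Require Import structures.
From mathcomp Require Import all_boot all_algebra boolp generic_quotient.
Require Import Defs.

(* The elements of Hom(X, Y[n]) in the derived category are computed by
   resolutions of X by arbitrary objects: after truncation, a roof is a cocycle
   f : Z_n -> Y on a resolution Z -> X, and it vanishes iff f becomes a
   coboundary on some refinement of Z.  With this description dimension shifting
   in both variables is elementary, and objects of alpha(T) are seen to lie in
   the right and in the left orthogonal of add T.  Hence Hom(T, -) turns the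
   conflations of alpha(T) into exact sequences; it is fully faithful on add T
   by Yoneda, so on every object with a T-resolution, and the resolution of X
   becomes a projective resolution of Hom(T, X) that stays exact under
   Hom(-, R).

   For the triangles, let F = Hom(T, -) and let FX -> I be the chosen embedding
   of FX.  The image of the standard triangle X -> Y -> Z is compared with the
   standard triangle on FX -> FY + F(IX), whose third term splits as FZ + I.
   This way one never needs that Gorenstein projectives are closed under
   extensions. *)

Set Implicit Arguments.
Unset Strict Implicit.
Unset Printing Implicit Defensive.

Import GRing.Theory.
Local Open Scope ring_scope.

(** * Abelian categories *)

(** An arbitrary abelian category need not have enough projectives or injectives, so no single
    resolution of X computes Ext, and every vanishing statement has to allow a further refinement.
    Only two fragments of long exact sequences are used: Ext(W, X) between Ext(W, E) and the next
    Ext(W, K) for K → E → X, and Ext(K, Y) between Ext(E, Y) and the next Ext(Q, Y) for K → E → Q.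
    The former is a chase, since all refinements are taken over the same W. The latter is the harder
    one: the refinements live over Q and over E, and one over K has to be extracted from them, which
    is the purpose of the cone and the fibre. Membership in alpha is an infinite condition, so it is
    always handled one short exact sequence at a time, by unfolding a step or by coinduction.
    Finitely generated projective modules enter the comparison as retracts of F S with S in add T,
    so that fullness of F applies to both halves of a map through them. Pushouts are rewritten as
    short exact sequences with a biproduct in the middle, a form that F preserves when the first
    term is right orthogonal to add T. *)

Section PreadditiveBasics.
Variable C : preadditive.

Lemma compBl (X Y Z : C) (g g' : hom Y Z) (f : hom X Y) :
  (g - g') ∘ f = g ∘ f - g' ∘ f.
Proof. by rewrite compDl compNm. Qed.

Lemma compBr (X Y Z : C) (g : hom Y Z) (f f' : hom X Y) :
  g ∘ (f - f') = g ∘ f - g ∘ f'.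
Proof. by rewrite compDr compmN. Qed.

Lemma to_zob (X : C) (f g : hom X zob) : f = g.
Proof. by rewrite -(comp1m f) -(comp1m g) zobP !comp0m. Qed.

Lemma from_zob (X : C) (f g : hom zob X) : f = g.
Proof. by rewrite -(compm1 f) -(compm1 g) zobP !compm0. Qed.

Lemma epi0 (X Y Z : C) (e : hom X Y) (f : hom Y Z) :
  epi e -> f ∘ e = 0 -> f = 0.
Proof. by move=> he fe0; apply: he; rewrite fe0 comp0m. Qed.

Lemma mono0 (X Y Z : C) (m : hom Y Z) (f : hom X Y) :
  mono m -> m ∘ f = 0 -> f = 0.
Proof. by move=> hm mf0; apply: hm; rewrite mf0 compm0. Qed.

Lemma epi_id (X : C) : epi (idm X).
Proof. by move=> W a b; rewrite !compm1. Qed.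

Lemma mono_id (X : C) : mono (idm X).
Proof. by move=> W a b; rewrite !comp1m. Qed.

Lemma epi_comp (X Y Z : C) (g : hom Y Z) (f : hom X Y) :
  epi g -> epi f -> epi (g ∘ f).
Proof. by move=> hg hf W a b; rewrite !compA => /hf/hg. Qed.

Lemma mono_comp (X Y Z : C) (g : hom Y Z) (f : hom X Y) :
  mono g -> mono f -> mono (g ∘ f).
Proof. by move=> hg hf W a b; rewrite -!compA => /hg/hf. Qed.

Lemma kernel_lift (X Y K W : C) (f : hom X Y) (k : hom K X) (h : hom W X) :
  is_kernel f k -> f ∘ h = 0 -> exists u, k ∘ u = h.
Proof. by move=> [_ kP] /kP[u [<- _]]; exists u. Qed.

Lemma coker_lift (X Y Q W : C) (f : hom X Y) (q : hom Y Q) (h : hom Y W) :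
  is_coker f q -> h ∘ f = 0 -> exists u, u ∘ q = h.
Proof. by move=> [_ qP] /qP[u [<- _]]; exists u. Qed.

Lemma intro_kernel (X Y K : C) (f : hom X Y) (k : hom K X) :
  f ∘ k = 0 -> mono k ->
  (forall (W : C) (h : hom W X), f ∘ h = 0 -> exists u, k ∘ u = h) ->
  is_kernel f k.
Proof.
move=> fk km kP; split=> // W h /kP[u ku]; exists u; split=> // v kv.
by apply: km; rewrite ku kv.
Qed.

Lemma intro_coker (X Y Q : C) (f : hom X Y) (q : hom Y Q) :
  q ∘ f = 0 -> epi q ->
  (forall (W : C) (h : hom Y W), h ∘ f = 0 -> exists u, u ∘ q = h) ->
  is_coker f q.
Proof.
move=> qf qe qP; split=> // W h /qP[u uq]; exists u; split=> // v vq.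
by apply: qe; rewrite uq vq.
Qed.

Lemma kernel_mono_comp (X Y Z K : C) (f : hom X Y) (m : hom Y Z) (k : hom K X) :
  mono m -> is_kernel (m ∘ f) k <-> is_kernel f k.
Proof.
move=> mm; split=> -[mfk kP].
  split=> [|W h fh]; first by apply: (mono0 mm); rewrite compA.
  by apply: kP; rewrite -compA fh compm0.
split=> [|W h mfh]; first by rewrite -compA mfk compm0.
by apply: kP; apply: (mono0 mm); rewrite compA.
Qed.

Lemma coker_epi_comp (X Y Z Q : C) (e : hom X Y) (f : hom Y Z) (q : hom Z Q) :
  epi e -> is_coker (f ∘ e) q <-> is_coker f q.
Proof.
move=> he; split=> -[qfe qP].
  split=> [|W h hf]; first by apply: (epi0 he); rewrite -compA.
  by apply: qP; rewrite compA hf comp0m.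
split=> [|W h hfe]; first by rewrite compA qfe comp0m.
by apply: qP; apply: (epi0 he); rewrite -compA.
Qed.

Section Biproduct.
Variables (X Y S : C) (i : hom X S) (j : hom Y S) (p : hom S X) (q : hom S Y).
Hypothesis bS : is_biproduct i j p q.

Lemma bip_pi : p ∘ i = idm X. Proof. by case: bS. Qed.
Lemma bip_qj : q ∘ j = idm Y. Proof. by case: bS. Qed.
Lemma bip_pj : p ∘ j = 0. Proof. by case: bS. Qed.
Lemma bip_qi : q ∘ i = 0. Proof. by case: bS. Qed.
Lemma bip_id : i ∘ p + j ∘ q = idm S. Proof. by case: bS. Qed.

Lemma bip_into (W : C) (a b : hom W S) :
  p ∘ a = p ∘ b -> q ∘ a = q ∘ b -> a = b.
Proof.
move=> pab qab.
by rewrite -(comp1m a) -(comp1m b) -bip_id !compDl -!compA pab qab.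
Qed.

Lemma bip_outof (W : C) (a b : hom S W) :
  a ∘ i = b ∘ i -> a ∘ j = b ∘ j -> a = b.
Proof.
move=> abi abj.
by rewrite -(compm1 a) -(compm1 b) -bip_id !compDr !compA abi abj.
Qed.

End Biproduct.

Lemma fmap0 (D : preadditive) (F : functor C D) (X Y : C) :
  fmap F (0 : hom X Y) = 0.
Proof. by apply: (addrI (fmap F 0)); rewrite -fmapD !addr0. Qed.

Lemma fmapN (D : preadditive) (F : functor C D) (X Y : C) (f : hom X Y) :
  fmap F (- f) = - fmap F f.
Proof. by apply: (addrI (fmap F f)); rewrite -fmapD !subrr fmap0. Qed.

Lemma fmapB (D : preadditive) (F : functor C D) (X Y : C) (f g : hom X Y) :
  fmap F (f - g) = fmap F f - fmap F g.
Proof. by rewrite fmapD fmapN. Qed.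

End PreadditiveBasics.

Section Abelian.
Variable C : preadditive.
Hypothesis abC : abelian_category C.

Lemma ex_bip (X Y : C) : exists (S : C) (i : hom X S) (j : hom Y S)
  (p : hom S X) (q : hom S Y), is_biproduct i j p q.
Proof. by case: abC. Qed.

Lemma ex_kernel (X Y : C) (f : hom X Y) : exists (K : C) (k : hom K X),
  is_kernel f k.
Proof. by case: abC. Qed.

Lemma ex_coker (X Y : C) (f : hom X Y) : exists (Q : C) (q : hom Y Q), is_coker
  f q.
Proof. by case: abC. Qed.

(** An epimorphism is the cokernel of some [g]; since [g] factors through [k], whatever kills [k]
    kills [g]. *)
Lemma epi_coker_kernel (X Y K : C) (f : hom X Y) (k : hom K X) :
  epi f -> is_kernel f k -> is_coker k f.
Proof.
case: abC => _ _ _ _ epiP fe kerk; case: (epiP _ _ f fe) => Z [g cokg].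
have [v kv] := kernel_lift kerk cokg.1.
apply: intro_coker => [|//|W h hk]; first exact: kerk.1.
by apply: (coker_lift cokg); rewrite -kv compA hk comp0m.
Qed.

Lemma mono_kernel_coker (X Y Q : C) (f : hom X Y) (q : hom Y Q) :
  mono f -> is_coker f q -> is_kernel q f.
Proof.
case: abC => _ _ _ monoP _ fm cokq; case: (monoP _ _ f fm) => Z [g kerg].
have [v vq] := coker_lift cokq kerg.1.
apply: intro_kernel => [|//|W h qh]; first exact: cokq.1.
by apply: (kernel_lift kerg); rewrite -vq -compA qh compm0.
Qed.

(** The pullback is the kernel of [m = f ∘ p - g ∘ q] on X + Y. As [m] is epi, it is the cokernel of
    that kernel. Two morphisms that agree after [f'] therefore differ, after [q], by some [c ∘ m];
    restricting to X gives [c ∘ f = 0], hence [c = 0]. *)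
Lemma pullback_epi (X Y Z : C) (f : hom X Z) (g : hom Y Z) : epi f ->
  exists (P : C) (g' : hom P X) (f' : hom P Y),
    [/\ epi f', f ∘ g' = g ∘ f',
        forall (W : C) (u v : hom W P), g' ∘ u = g' ∘ v -> f' ∘ u = f' ∘ v ->
          u = v
      & forall (W : C) (a : hom W X) (b : hom W Y), f ∘ a = g ∘ b ->
          exists u, g' ∘ u = a /\ f' ∘ u = b].
Proof.
move=> fe; have [S [i [j [p [q bS]]]]] := ex_bip X Y.
pose m := f ∘ p - g ∘ q.
have mi : m ∘ i = f.
  by rewrite compBl -!compA (bip_pi bS) (bip_qi bS) compm1 compm0 subr0.
have mj : m ∘ j = - g.
  by rewrite compBl -!compA (bip_pj bS) (bip_qj bS) compm1 compm0 sub0r.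
have me : epi m by move=> W a b e; apply: fe; rewrite -mi !compA e.
have [P [k kerk]] := ex_kernel m; have cokm := epi_coker_kernel me kerk.
have mk : f ∘ (p ∘ k) = g ∘ (q ∘ k).
  by apply/eqP; rewrite -subr_eq0 !compA -compBl kerk.1.
exists P, (p ∘ k), (q ∘ k); split=> // [W a b e|W u v|W a b e].
  have [|c cm] := coker_lift (h := (a - b) ∘ q) cokm.
    by rewrite -compA compBl e subrr.
  have c0 : c = 0.
    by apply: (epi0 fe); rewrite -mi compA cm -compA (bip_qi bS) compm0.
  apply/eqP; rewrite -subr_eq0; apply/eqP.
  by rewrite -(compm1 (a - b)) -(bip_qj bS) compA -cm c0 !comp0m.
  rewrite -!compA => pe qe.
  by apply: (is_kernel_mono kerk); apply: (bip_into bS).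
have [|u ku] := kernel_lift (h := i ∘ a + j ∘ b) kerk.
  by rewrite compDr !compA mi mj e compNm subrr.
exists u; rewrite -!compA ku !compDr !compA.
rewrite (bip_pi bS) (bip_qi bS) (bip_pj bS) (bip_qj bS).
by rewrite !comp1m !comp0m addr0 add0r.
Qed.

(* Exactness by generalized elements: morphisms into an object play the role of
   its elements, and preimages exist after pulling back along an epimorphism. *)
Definition exact_gen (X Y Z : C) (f : hom X Y) (g : hom Y Z) :=
  g ∘ f = 0 /\ forall (V : C) (y : hom V Y), g ∘ y = 0 ->
    exists (V' : C) (e : hom V' V) (x : hom V' X), epi e /\ f ∘ x = y ∘ e.

Lemma epi_lift (X Y V : C) (f : hom X Y) (y : hom V Y) : epi f ->
  exists (V' : C) (e : hom V' V) (x : hom V' X), epi e /\ f ∘ x = y ∘ e.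
Proof. by move=> /(pullback_epi y)[P [x [e [ee fx _ _]]]]; exists P, e, x. Qed.

Lemma epi_of_lift (X Y V' : C) (f : hom X Y) (e : hom V' Y) (x : hom V' X) :
  epi e -> f ∘ x = e -> epi f.
Proof. by move=> ee fx W a b ab; apply: ee; rewrite -fx !compA ab. Qed.

(** The lift exists after an epimorphism [e]. It kills the kernel of [e] because [f] is mono, so it
    descends along [e]. *)
Lemma kernel_of_gen (X Y Z : C) (f : hom X Y) (g : hom Y Z) :
  mono f -> exact_gen f g -> is_kernel g f.
Proof.
move=> fm [gf fP]; apply: intro_kernel => // W h /fP[V' [e [x [ee fx]]]].
have [K [k kerk]] := ex_kernel e; have coke := epi_coker_kernel ee kerk.
have [|u ue] := coker_lift (h := x) coke.
  by apply: (mono0 fm); rewrite compA fx -compA kerk.1 compm0.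
by exists u; apply: ee; rewrite -compA ue.
Qed.

Lemma short_exact_kernel (X Y Z : C) (f : hom X Y) (g : hom Y Z) :
  epi g -> is_kernel g f -> short_exact f g.
Proof. by move=> ge kerf; split=> //; apply: epi_coker_kernel. Qed.

Lemma short_exact_coker (X Y Z : C) (f : hom X Y) (g : hom Y Z) :
  mono f -> is_coker f g -> short_exact f g.
Proof. by move=> fm cokg; split=> //; apply: mono_kernel_coker. Qed.

(** Suppose [a ∘ p = 0] and let [k] be the kernel of [a]. The mono [i ∘ k] is the kernel of some
    [h], and [h] kills [f], so it factors through [q] and kills [i]. Thus [i] factors through
    [i ∘ k], so [k] is a split epimorphism and [a = 0]. *)
Lemma image_factor (X Y I Q : C) (f : hom X Y) (q : hom Y Q) (i : hom I Y) :
  is_coker f q -> is_kernel q i -> exists p, epi p /\ i ∘ p = f.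
Proof.
move=> cokq keri; have [p ip] := kernel_lift keri cokq.1.
exists p; split=> //; have im := is_kernel_mono keri.
suff p0 W (a : hom I W) : a ∘ p = 0 -> a = 0.
  move=> W a b ab; apply/eqP; rewrite -subr_eq0; apply/eqP/p0.
  by rewrite compBl ab subrr.
move=> ap; have [K [k kerk]] := ex_kernel a.
have [v kv] := kernel_lift kerk ap.
have mm : mono (i ∘ k) by apply: mono_comp im (is_kernel_mono kerk).
case: abC => _ _ _ monoP _; have [Z [h kerh]] := monoP _ _ _ mm.
have [|h' h'q] := coker_lift (h := h) cokq.
  by rewrite -ip -kv !compA -[_ ∘ i ∘ k]compA kerh.1 comp0m.
have [|u iku] := kernel_lift (h := i) kerh.
  by rewrite -h'q -compA keri.1 compm0.
have ku : k ∘ u = idm I by apply: im; rewrite compA iku compm1.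
by rewrite -(compm1 a) -ku compA kerk.1 comp0m.
Qed.

Lemma exact_atP (X Y Z : C) (f : hom X Y) (g : hom Y Z) :
  exact_at f g <-> exact_gen f g.
Proof.
split=> [[I [i [[Q [q [cokq keri]]] keri']]]|[gf fgP]].
  have [p [pe ip]] := image_factor cokq keri.
  split=> [|V y gy]; first by rewrite -ip compA keri'.1 comp0m.
  have [u iu] := kernel_lift keri' gy.
  have [V' [e [x [ee px]]]] := epi_lift u pe.
  by exists V', e, x; rewrite -ip -iu -!compA px.
have [Q [q cokq]] := ex_coker f; have [I [i keri]] := ex_kernel q.
exists I, i; split; first by exists Q, q.
have [p [pe ip]] := image_factor cokq keri.
apply: kernel_of_gen; first exact: is_kernel_mono keri.
split=> [|V y /fgP[V' [e [x [ee fx]]]]].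
  by apply: (epi0 pe); rewrite -compA ip.
by exists V', e, (p ∘ x); split=> //; rewrite compA ip.
Qed.

End Abelian.

(** * Resolutions and vanishing of Ext *)

Section Resolutions.
Variable C : preadditive.

(** The terms are arbitrary objects; boundedness makes the associated complex an admissible apex of
    a roof in the bounded derived category. *)
Record resolution (X : C) := Resolution {
  robj :> nat -> C;
  raug : hom (robj 0) X;
  rdif : forall i, hom (robj i.+1) (robj i);
  raug_epi : epi raug;
  raug_exact : exact_gen (rdif 0) raug;
  rdif_exact : forall i, exact_gen (rdif i.+1) (rdif i);
  robj_bounded : exists N, forall i, (N < i)%N -> idm (robj i) = 0
}.

#[global] Arguments raug_epi {X} r : rename.
#[global] Arguments raug_exact {X} r : rename.
#[global] Arguments rdif_exact {X} r i : rename.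
#[global] Arguments robj_bounded {X} r : rename.

Record rmap (X' X : C) (g : hom X' X) (Z' : resolution X') (Z : resolution X) :=
  RMap {
  rmor :> forall i, hom (Z' i) (Z i);
  rmor_aug : raug Z ∘ rmor 0 = g ∘ raug Z';
  rmor_dif : forall i, rdif Z i ∘ rmor i.+1 = rmor i ∘ rdif Z' i
}.

Lemma raug_dif (X : C) (Z : resolution X) : raug Z ∘ rdif Z 0 = 0.
Proof. by case: (raug_exact Z). Qed.

Lemma rdif2 (X : C) (Z : resolution X) i : rdif Z i ∘ rdif Z i.+1 = 0.
Proof. by case: (rdif_exact Z i). Qed.

Lemma rmap_comp_subproof (X : C) (Z Z' Z'' : resolution X)
    (t : rmap (idm X) Z' Z) (t' : rmap (idm X) Z'' Z') :
  raug Z ∘ (t 0 ∘ t' 0) = idm X ∘ raug Z'' /\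
  forall i, rdif Z i ∘ (t i.+1 ∘ t' i.+1) = (t i ∘ t' i) ∘ rdif Z'' i.
Proof.
split=> [|i]; first by rewrite compA !rmor_aug -compA rmor_aug comp1m.
by rewrite compA rmor_dif -compA rmor_dif compA.
Qed.

Definition rmap_comp (X : C) (Z Z' Z'' : resolution X)
    (t : rmap (idm X) Z' Z) (t' : rmap (idm X) Z'' Z') : rmap (idm X) Z'' Z :=
  RMap (rmap_comp_subproof t t').1 (rmap_comp_subproof t t').2.


Hypothesis abC : abelian_category C.

Section Splice.
Variables (K E Q : C) (k : hom K E) (q : hom E Q).
Hypothesis kq : short_exact k q.
Variable Z : resolution K.

Definition splice_obj (i : nat) : C := if i is j.+1 then Z j else E.

Definition splice_dif (i : nat) : hom (splice_obj i.+1) (splice_obj i) :=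
  match i with 0 => k ∘ raug Z | j.+1 => rdif Z j end.

Lemma splice_aug_exact : exact_gen (splice_dif 0) q.
Proof.
split=> [|V y qy] /=; first by rewrite compA kq.1.1 comp0m.
have [u ku] := kernel_lift kq.1 qy.
have [V' [e [x [ee zx]]]] := epi_lift abC u (raug_epi Z).
by exists V', e, x; rewrite -compA zx compA ku.
Qed.

Lemma splice_dif_exact i : exact_gen (splice_dif i.+1) (splice_dif i).
Proof.
case: i => [|i] /=; last exact: rdif_exact.
split=> [|V y kry]; first by rewrite -compA raug_dif compm0.
apply: (raug_exact Z).2; apply: (mono0 (is_kernel_mono kq.1)).
by rewrite compA.
Qed.

Lemma splice_bounded :
  exists N, forall i, (N < i)%N -> idm (splice_obj i) = 0.
Proof.
by have [N NP] := robj_bounded Z; exists N.+1; case=> // i; apply: NP.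
Qed.

Definition splice : resolution Q :=
  Resolution (is_coker_epi kq.2) splice_aug_exact splice_dif_exact
    splice_bounded.

End Splice.

Section Tail.
Variables (X B : C) (Z : resolution X) (b : hom B (Z 0%N)) (p : hom (Z 1%N) B).
Hypotheses (kerb : is_kernel (raug Z) b) (bp : b ∘ p = rdif Z 0).

Let bm : mono b := is_kernel_mono kerb.

Lemma tail_aug_epi : epi p.
Proof.
have [V' [e [x [ee zx]]]] := (raug_exact Z).2 _ _ kerb.1.
apply: (epi_of_lift (x := x) ee).
by apply: bm; rewrite compA bp zx.
Qed.

Lemma tail_aug_exact : exact_gen (rdif Z 1) p.
Proof.
split=> [|V y py]; first by apply: (mono0 bm); rewrite compA bp rdif2.
by apply: (rdif_exact Z 0).2; rewrite -bp -compA py compm0.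
Qed.

Lemma tail_bounded : exists N, forall i, (N < i)%N -> idm (Z i.+1) = 0.
Proof. by have [N NP] := robj_bounded Z; exists N => i /leqW; apply: NP. Qed.

Definition tail : resolution B :=
  @Resolution B (fun i => Z i.+1) p (fun i => rdif Z i.+1) tail_aug_epi
    tail_aug_exact (fun i => rdif_exact Z i.+1) tail_bounded.

End Tail.

Lemma ex_tail (X : C) (Z : resolution X) :
  exists (B : C) (b : hom B (Z 0%N)) (p : hom (Z 1%N) B),
    is_kernel (raug Z) b /\ b ∘ p = rdif Z 0.
Proof.
have [B [b kerb]] := ex_kernel abC (raug Z).
have [p bp] := kernel_lift kerb (raug_dif Z).
by exists B, b, p.
Qed.

(** Only the term in degree 0 is pulled back: the augmentation and its pullback have the same
    kernel, so the higher terms can stay. *)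
Lemma ex_pullback_resolution (X' X : C) (g : hom X' X) (Z : resolution X) :
  exists Z' : resolution X', inhabited (rmap g Z' Z).
Proof.
have [P [z0 [a [ae za Pinj PP]]]] := pullback_epi abC g (raug_epi Z).
have [|d0 [zd0 ad0]] := PP _ (rdif Z 0) 0; first by rewrite raug_dif compm0.
pose O i : C := if i is j.+1 then Z j.+1 else P.
pose d i : hom (O i.+1) (O i) := match i with 0 => d0 | j.+1 => rdif Z j.+1 end.
pose t i : hom (O i) (Z i) := match i with 0 => z0 | j.+1 => idm (Z j.+1) end.
have exa : exact_gen (d 0%N) a.
  split=> // V y ay.
  have [|V' [e [x [ee zx]]]] := (raug_exact Z).2 _ (z0 ∘ y).
    by rewrite compA za -compA ay compm0.
  exists V', e, x; split=> //; apply: Pinj; first by rewrite !compA zd0 zx.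
  by rewrite !compA ad0 ay !comp0m.
have exd i : exact_gen (d i.+1) (d i).
  case: i => [|i] /=; last exact: rdif_exact.
  split=> [|V y dy].
    by apply: Pinj; rewrite !compA ?zd0 ?ad0 ?rdif2 ?comp0m compm0.
  by apply: (rdif_exact Z 0).2; rewrite -zd0 -compA dy compm0.
have bO : exists N, forall i, (N < i)%N -> idm (O i) = 0.
  by have [N NP] := robj_bounded Z; exists N; case=> // i; apply: NP.
exists (Resolution ae exa exd bO); split; exists t => //= -[|i] /=.
  by rewrite zd0 compm1.
by rewrite comp1m compm1.
Qed.

(* Any epimorphism onto Q that factors through Z_0 can serve as the first step
   of a refinement of Z. *)
Lemma rebase (K P Q : C) (k : hom K P) (q : hom P Q) (kq : short_exact k q)
    (Z : resolution Q) (l : hom P (Z 0%N)) : raug Z ∘ l = q ->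
  exists (N : resolution K) (t : rmap (idm Q) (splice kq N) Z), t 0%N = l.
Proof.
move=> zl; have [B [b [p [kerb bp]]]] := ex_tail Z.
have [g bg] : exists g, b ∘ g = l ∘ k.
  by apply: (kernel_lift kerb); rewrite compA zl kq.1.1.
have [N [t]] := ex_pullback_resolution g (tail kerb bp); exists N.
pose s i : hom (splice kq N i) (Z i) := match i with 0 => l | j.+1 => t j end.
have s_aug : raug Z ∘ s 0%N = idm Q ∘ raug (splice kq N) by rewrite comp1m.
have s_dif i : rdif Z i ∘ s i.+1 = s i ∘ rdif (splice kq N) i.
  case: i => [|i] /=; last exact: (rmor_dif t).
  by rewrite -bp -compA [p ∘ _](rmor_aug t) !compA bg.
by exists (RMap s_aug s_dif).
Qed.

(** In degree 0 the epimorphism [raug Z ∘ p] is a new first step. In degree i + 1 the tail, which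
    resolves the kernel of the augmentation, is refined and then spliced back onto [Z 0]. *)
Lemma refine_resolution (X : C) (Z : resolution X) i (P : C) (p : hom P (Z i)) :
  epi p -> exists (Z' : resolution X) (t : rmap (idm X) Z' Z) 
    (u : hom (Z' i) P),
    p ∘ u = t i.
Proof.
move=> pe; elim: i X Z p pe => [|i IH] X Z p pe.
  have [K [k kerk]] := ex_kernel abC (raug Z ∘ p).
  have kq := short_exact_kernel abC (epi_comp (raug_epi Z) pe) kerk.
  have [N [t t0]] := rebase kq (erefl (raug Z ∘ p)).
  by exists (splice kq N), t, (idm P); rewrite t0 compm1.
have [B [b [q [kerb bq]]]] := ex_tail Z.
have [N [t [u pu]]] := IH B (tail kerb bq) p pe.
have bZ := short_exact_kernel abC (raug_epi Z) kerb.
pose s i : hom (splice bZ N i) (Z i) := match i with 0 => idm (Z 0%N) | j.+1 =>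
  t j end.
have s_aug : raug Z ∘ s 0%N = idm X ∘ raug (splice bZ N).
  by rewrite compm1 comp1m.
have s_dif j : rdif Z j ∘ s j.+1 = s j ∘ rdif (splice bZ N) j.
  case: j => [|j] /=; last exact: (rmor_dif t).
  by rewrite -bq -compA [q ∘ _](rmor_aug t) !comp1m.
by exists (splice bZ N), (RMap s_aug s_dif), u.
Qed.

(* Vanishing of Ext^(m+1)(X, Y), expressed by resolutions of X by arbitrary
   objects: every cocycle becomes a coboundary on some refinement. *)
Definition ext_null (m : nat) (X Y : C) :=
  forall (Z : resolution X) (f : hom (Z m.+1) Y), f ∘ rdif Z m.+1 = 0 ->
  exists (Z' : resolution X) (t : rmap (idm X) Z' Z) (s : hom (Z' m) Y),
    f ∘ t m.+1 = s ∘ rdif Z' m.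

Definition projective (P : C) :=
  forall (X Y : C) (g : hom X Y) (f : hom P Y), epi g -> exists h, g ∘ h = f.

Lemma ext_null_retract m (X Y Y' : C) (j : hom Y Y') (p : hom Y' Y) :
  p ∘ j = idm Y -> ext_null m X Y' -> ext_null m X Y.
Proof.
move=> pj ext Z f fd; have [|Z' [t [s ft]]] := ext Z (j ∘ f).
  by rewrite -compA fd compm0.
by exists Z', t, (p ∘ s); rewrite -compA -ft !compA pj comp1m.
Qed.

(** Projectivity lifts [q] through the augmentation of Z, so Z is refined by a resolution that
    starts with P. The cocycle factors through the kernel B of the augmentation of Z; its
    restriction to K extends to P, and the extension is the required cochain. *)
Lemma ext_null0_projective (K P Q Y : C) (k : hom K P) (q : hom P Q) :
  short_exact k q -> projective P ->
  (forall f : hom K Y, exists g : hom P Y, g ∘ k = f) -> ext_null 0 Q Y.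
Proof.
move=> kq projP extY Z f fd; have [l zl] := projP _ _ _ q (raug_epi Z).
have [B [b [p [kerb bp]]]] := ex_tail Z.
have [N [t t0]] := rebase kq zl.
have [D [d kerd]] := ex_kernel abC p.
have cokp := epi_coker_kernel abC (tail_aug_epi kerb bp) kerd.
have [|g gp] := coker_lift (h := f) cokp.
  have [V [e [x [ee dx]]]] := (tail_aug_exact kerb bp).2 _ _ kerd.1.
  by apply: (epi0 ee); rewrite -compA -dx compA fd comp0m.
have [c bc] : exists c, b ∘ c = l ∘ k.
  by apply: (kernel_lift kerb); rewrite compA zl kq.1.1.
have [h hk] := extY (g ∘ c).
exists (splice kq N), t, h => /=; rewrite compA hk -gp -!compA; congr (g ∘ _).
apply: (is_kernel_mono kerb); rewrite !compA bp bc.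
by have /= := rmor_dif t 0; rewrite t0 compA.
Qed.

Lemma ext_nullS_projective m (K P Q Y : C) (k : hom K P) (q : hom P Q) :
  short_exact k q -> projective P -> ext_null m K Y -> ext_null m.+1 Q Y.
Proof.
move=> kq projP ext Z f fd; have [l zl] := projP _ _ _ q (raug_epi Z).
have [N [t t0]] := rebase kq zl.
have [|N' [t' [s ft']]] := ext N (f ∘ t m.+2).
  by rewrite -compA -[_ ∘ rdif N _](rmor_dif t m.+2) compA fd comp0m.
pose u i : hom (splice kq N' i) (splice kq N i) :=
  match i with 0 => idm P | j.+1 => t' j end.
have u_aug : raug (splice kq N) ∘ u 0%N = idm Q ∘ raug (splice kq N').
  by rewrite compm1 comp1m.
have u_dif j : rdif (splice kq N) j ∘ u j.+1 = u j ∘ rdif (splice kq N') j.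
  case: j => [|j] /=; last exact: (rmor_dif t').
  by rewrite -compA (rmor_aug t') !comp1m.
by exists (splice kq N'), (rmap_comp t (RMap u_aug u_dif)), s => /=;
  rewrite compA.
Qed.

Lemma short_exact_zob_id (P : C) : short_exact (0 : hom zob P) (idm P).
Proof.
apply: short_exact_kernel => //; first exact: epi_id.
apply: intro_kernel => [|W a b _|W h]; first by rewrite compm0.
  exact: to_zob.
by rewrite comp1m => ->; exists 0; rewrite compm0.
Qed.

(** The sequence 0 → P → P shifts the dimension down to the zero object, which is again
    projective. *)
Lemma ext_null_projective m (P Y : C) : projective P -> ext_null m P Y.
Proof.
elim: m P => [|m IH] P projP.
  apply: (ext_null0_projective (short_exact_zob_id P) projP) => f.
  by exists 0; apply: from_zob.
apply: (ext_nullS_projective (short_exact_zob_id P) projP); apply: IH.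
by move=> X X' g f _; exists 0; apply: from_zob.
Qed.

(** After a refinement the cocycle [f] lifts to a cochain in E. The coboundary of the lift takes
    values in K and is a cocycle [c] one degree up; where [c] is the coboundary of [s], correcting
    the lift by [k ∘ s] gives a cocycle in E, whose cobounding cochain is pushed down by [e]. *)
Lemma ext_null_quotient m (W K E X : C) (k : hom K E) (e : hom E X) :
  short_exact k e -> ext_null m W E -> ext_null m.+1 W K -> ext_null m W X.
Proof.
move=> [kerk coke] extE extK Z f fd; have ee := is_coker_epi coke.
have km := is_kernel_mono kerk.
have [P [x [p [pe xp _ _]]]] := pullback_epi abC f ee.
have [Z1 [t1 [u pu]]] := refine_resolution pe.
have exu : e ∘ (x ∘ u) = f ∘ t1 m.+1 by rewrite compA xp -compA pu.
have [c kc] : exists c, k ∘ c = x ∘ u ∘ rdif Z1 m.+1.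
  apply: (kernel_lift kerk).
  by rewrite compA exu -compA -(rmor_dif t1) compA fd comp0m.
have [|Z2 [t2 [s ct2]]] := extK Z1 c.
  by apply: (mono0 km); rewrite compA kc -compA rdif2 compm0.
have [|Z3 [t3 [r rt3]]] := extE Z2 (x ∘ u ∘ t2 m.+1 - k ∘ s).
  rewrite compBl -!compA -(rmor_dif t2) -ct2 !compA kc.
  by rewrite -!compA subrr.
exists Z3, (rmap_comp (rmap_comp t1 t2) t3), (e ∘ r) => /=.
rewrite -[RHS]compA -rt3 compBl compBr !compA kerk.1 !comp0m subr0.
by rewrite -(compA f) -pu !compA xp.
Qed.

(** Biproducts are chosen by [cid] because the terms and differentials of cones and fibres have to
    be functions of the degree. *)
Definition bip_obj (X Y : C) : C := projT1 (cid (ex_bip abC X Y)).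

Definition bip_data (X Y : C) :
  {m : (hom X (bip_obj X Y) * hom Y (bip_obj X Y)) *
    (hom (bip_obj X Y) X * hom (bip_obj X Y) Y) |
  is_biproduct m.1.1 m.1.2 m.2.1 m.2.2}.
Proof.
rewrite /bip_obj; case: cid => S bS /=; apply: cid.
by have [i [j [p [q ?]]]] := bS; exists (i, j, (p, q)).
Qed.

Section Pairing.
Variables X Y : C.

Definition inl_ : hom X (bip_obj X Y) := (projT1 (bip_data X Y)).1.1.
Definition inr_ : hom Y (bip_obj X Y) := (projT1 (bip_data X Y)).1.2.
Definition prl : hom (bip_obj X Y) X := (projT1 (bip_data X Y)).2.1.
Definition prr : hom (bip_obj X Y) Y := (projT1 (bip_data X Y)).2.2.

Lemma bip_objP : is_biproduct inl_ inr_ prl prr.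
Proof. exact: (projT2 (bip_data X Y)). Qed.

Definition pair_ (W : C) (a : hom W X) (b : hom W Y) := inl_ ∘ a + inr_ ∘ b.

Lemma prl_pair (W : C) (a : hom W X) (b : hom W Y) : prl ∘ pair_ a b = a.
Proof.
by rewrite compDr !compA (bip_pi bip_objP) (bip_pj bip_objP) comp1m comp0m
  addr0.
Qed.

Lemma prr_pair (W : C) (a : hom W X) (b : hom W Y) : prr ∘ pair_ a b = b.
Proof.
by rewrite compDr !compA (bip_qi bip_objP) (bip_qj bip_objP) comp1m comp0m
  add0r.
Qed.

Lemma pair_comp (W V : C) (a : hom W X) (b : hom W Y) (c : hom V W) :
  pair_ a b ∘ c = pair_ (a ∘ c) (b ∘ c).
Proof. by rewrite /pair_ compDl -!compA. Qed.

Lemma eq_pair (W : C) (a b : hom W (bip_obj X Y)) :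
  prl ∘ a = prl ∘ b -> prr ∘ a = prr ∘ b -> a = b.
Proof. exact: (bip_into bip_objP). Qed.

End Pairing.
End Resolutions.

(** * The cone of a refinement of a spliced resolution *)

Section Cone.
Variable C : preadditive.
Hypothesis abC : abelian_category C.
Variables (K E Q : C) (k : hom K E) (q : hom E Q).
Hypothesis kq : short_exact k q.
Variables (Z : resolution K) (W : resolution Q).
Variable t : rmap (idm Q) W (splice abC kq Z).

Let km : mono k := is_kernel_mono kq.1.

Let t0 : hom (W 0%N) E := t 0%N.
Let tS i : hom (W i.+1) (Z i) := t i.+1.

Lemma cone_t_aug : q ∘ t0 = raug W.
Proof. by rewrite [LHS](rmor_aug t) comp1m. Qed.

Lemma cone_t0 : t0 ∘ rdif W 0 = k ∘ raug Z ∘ tS 0.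
Proof. by rewrite [RHS](rmor_dif t 0). Qed.

Lemma cone_tS i : tS i ∘ rdif W i.+1 = rdif Z i ∘ tS i.+1.
Proof. by rewrite [RHS](rmor_dif t i.+1). Qed.

Notation V i := (bip_obj abC (W i) (Z i)).
Notation pl := (prl abC _ _).
Notation pr := (prr abC _ _).

(* The cone W_i + Z_i of t, with the summands W_0 and Q cancelled, resolves E. *)
Definition cone_dif i : hom (V i.+1) (V i) :=
  pair_ abC (- (rdif W i ∘ pl)) (tS i ∘ pl + rdif Z i ∘ pr).

Definition cone_aug : hom (V 0) E := t0 ∘ pl + k ∘ raug Z ∘ pr.

(** The image in Q of an element of E lifts to [W 0]; the error in E then lies in K and lifts to
    [Z 0]. *)
Lemma cone_aug_epi : epi cone_aug.
Proof.
have [V1 [e1 [w [ee1 wE]]]] := epi_lift abC q (raug_epi W).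
have [|y ky] := kernel_lift (h := e1 - t0 ∘ w) kq.1.
  by rewrite compBr compA cone_t_aug wE subrr.
have [V2 [e2 [z [ee2 zy]]]] := epi_lift abC y (raug_epi Z).
apply: (epi_of_lift (x := pair_ abC (w ∘ e2) z) (epi_comp ee1 ee2)).
rewrite compDl -!compA prl_pair prr_pair zy !compA ky compBl.
by rewrite addrC subrK.
Qed.

Lemma cone_aug_exact : exact_gen (cone_dif 0) cone_aug.
Proof.
split=> [|X y].
  rewrite compDl -!(compA _ pl) -!(compA _ pr) prl_pair prr_pair.
  rewrite compmN compDr !compA cone_t0 -[_ ∘ raug Z ∘ rdif Z 0]compA raug_dif.
  by rewrite compm0 comp0m addr0 addNr.
rewrite compDl -!(compA _ pl) -!(compA _ pr) => y0.
have [|X1 [e1 [w [ee1 dw]]]] := (raug_exact W).2 _ (pl ∘ y).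
  rewrite -cone_t_aug -compA; apply/eqP.
  by rewrite -(addr0 (q ∘ _)) -[X in _ + X](comp0m _ (raug Z ∘ (pr ∘ y)))
             -kq.1.1 -compA [k ∘ (_ ∘ _)]compA -compDr y0 compm0.
have [|X2 [e2 [z [ee2 dz]]]] := (raug_exact Z).2 _ (pr ∘ y ∘ e1 + tS 0 ∘ w).
  apply: (mono0 km); rewrite !compDr !compA.
  move: y0 => /(congr1 (fun h => h ∘ e1)).
  rewrite compDl comp0m !compA -[t0 ∘ _ ∘ _ ∘ _]compA => y0.
  rewrite -cone_t0 -[t0 ∘ _ ∘ w]compA dw addrC.
  by rewrite -y0 !compA.
exists X2, (e1 ∘ e2), (pair_ abC (- (w ∘ e2)) z); split; first exact: epi_comp.
rewrite pair_comp compNm -!compA compDl -!compA prl_pair prr_pair.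
apply: eq_pair; rewrite ?prl_pair ?prr_pair.
  by rewrite !compmN opprK !compA dw.
by rewrite dz compmN compDl -!compA addrC addrK.
Qed.

Lemma cone_dif_exact i : exact_gen (cone_dif i.+1) (cone_dif i).
Proof.
split=> [|X y].
  rewrite pair_comp compNm compDl -!compA prl_pair prr_pair.
  apply: eq_pair; rewrite ?prl_pair ?prr_pair compm0.
    by rewrite compmN !compA rdif2 comp0m !oppr0.
  rewrite compmN compDr !compA rdif2 comp0m addr0 cone_tS addNr //.
rewrite pair_comp compNm compDl -!compA => y0.
have y0l : rdif W i ∘ (pl ∘ y) = 0.
  apply/eqP; rewrite -oppr_eq0; apply/eqP.
  by rewrite -[LHS](prl_pair abC _ (tS i ∘ (pl ∘ y) + rdif Z i ∘ (pr ∘ y))) y0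
    compm0.
have y0r : tS i ∘ (pl ∘ y) + rdif Z i ∘ (pr ∘ y) = 0.
  by rewrite -[LHS](prr_pair abC (- (rdif W i ∘ (pl ∘ y)))) y0 compm0.
have [X1 [e1 [w [ee1 dw]]]] := (rdif_exact W i).2 _ _ y0l.
have [|X2 [e2 [z [ee2 dz]]]] := (rdif_exact Z i).2 _ (pr ∘ y ∘ e1 + tS i.+1 ∘ w).
  move: y0r => /(congr1 (fun h => h ∘ e1)); rewrite compDl comp0m => <-.
  by rewrite compDr !compA -cone_tS -!compA dw addrC -!compA.
exists X2, (e1 ∘ e2), (pair_ abC (- (w ∘ e2)) z); split; first exact: epi_comp.
rewrite pair_comp compNm compDl -!compA prl_pair prr_pair.
apply: eq_pair; rewrite ?prl_pair ?prr_pair.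
  by rewrite !compmN opprK !compA dw.
by rewrite dz compmN compDl -!compA addrC addrK.
Qed.

Lemma cone_bounded : exists N, forall i, (N < i)%N -> idm (V i) = 0.
Proof.
have [N NP] := robj_bounded Z; have [M MP] := robj_bounded W.
exists (maxn N M) => i; rewrite gtn_max => /andP[/NP idZ /MP idW].
rewrite -(bip_id (bip_objP abC _ _)).
rewrite -[inl_ _ _ _]compm1 idW compm0 comp0m add0r.
by rewrite -[inr_ _ _ _]compm1 idZ compm0 comp0m.
Qed.

Definition cone : resolution E :=
  Resolution cone_aug_epi cone_aug_exact cone_dif_exact cone_bounded.

End Cone.

(** * The fibre of a refinement of the cone over the resolution of the quotient *)

Section Fiber.
Variable C : preadditive.
Hypothesis abC : abelian_category C.
Variables (K E Q : C) (k : hom K E) (q : hom E Q).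
Hypothesis kq : short_exact k q.
Variables (Z : resolution K) (W : resolution Q).
Variable t : rmap (idm Q) W (splice abC kq Z).
Variable U : resolution E.

Let km : mono k := is_kernel_mono kq.1.
Let t0 : hom (W 0%N) E := t 0%N.
Let tS i : hom (W i.+1) (Z i) := t i.+1.

Notation pl := (prl abC _ _).
Notation pr := (prr abC _ _).

Variables (a : forall i, hom (U i) (W i)) (b : forall i, hom (U i) (Z i)).
Hypotheses (fiber_aug : t0 ∘ a 0 + k ∘ raug Z ∘ b 0 = raug U)
  (fiber_a : forall i, a i ∘ rdif U i = - (rdif W i ∘ a i.+1))
  (fiber_b : forall i, b i ∘ rdif U i = tS i ∘ a i.+1 + rdif Z i ∘ b i.+1).

Notation G i := (bip_obj abC (U i) (W i.+1)).

Let D i : hom (G i.+1) (G i) :=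
  pair_ abC (rdif U i ∘ pl) (rdif W i.+1 ∘ pr - a i.+1 ∘ pl).

Let m i : hom (G i) (Z i) := b i ∘ pl + tS i ∘ pr.

Let c : hom (G 0) (W 0%N) := a 0 ∘ pl - rdif W 0 ∘ pr.

(** Here [a] and [b] are the two components of a map from U to the cone. The terms in
    [tS i ∘ a i.+1] coming from [fiber_b] and from [D] cancel, which dictates the sign in [D]. *)
Lemma fiber_mD i : m i ∘ D i = rdif Z i ∘ m i.+1.
Proof.
rewrite /m compDl -!compA prl_pair prr_pair compBr compDr !compA fiber_b.
by rewrite cone_tS compDl -!compA addrC addrA subrK addrC.
Qed.

Lemma fiber_cD : c ∘ D 0 = 0.
Proof.
rewrite compBl -!compA prl_pair prr_pair compBr !compA rdif2 comp0m sub0r.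
by rewrite fiber_a compNm opprK addNr.
Qed.

Lemma fiber_DD i : D i ∘ D i.+1 = 0.
Proof.
rewrite pair_comp compBl -!compA prl_pair prr_pair.
apply: eq_pair; rewrite ?prl_pair ?prr_pair compm0.
  by rewrite compA rdif2 comp0m.
rewrite compBr !compA rdif2 comp0m sub0r fiber_a compNm opprK addNr //.
Qed.

Lemma fiber_lift i (X X1 : C) (y : hom X (G i)) (e : hom X1 X) (v : hom X1 (U
  i.+1)) :
  epi e -> a i ∘ (pl ∘ y) = rdif W i ∘ (pr ∘ y) ->
  rdif U i ∘ v = pl ∘ y ∘ e ->
  exists (V' : C) (e' : hom V' X) (x : hom V' (G i.+1)), epi e' /\ D i ∘ x = y
    ∘ e'.
Proof.
move=> ee ay dv.
have [|X2 [e2 [w [ee2 dw]]]] := (rdif_exact W i).2 _ (pr ∘ y ∘ e + a i.+1 ∘ v).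
  rewrite compDr !compA -[rdif W i ∘ pr ∘ y]compA -ay -!compA.
  by rewrite [pl ∘ (y ∘ e)]compA -dv compA fiber_a compNm -!compA addNr.
exists X2, (e ∘ e2), (pair_ abC (v ∘ e2) w); split; first exact: epi_comp.
rewrite pair_comp compBl -!compA prl_pair prr_pair.
apply: eq_pair; rewrite ?prl_pair ?prr_pair; first by rewrite !compA dv.
by rewrite dw compDl -!compA addrK.
Qed.

(* The fibre of U -> W is U_i + W_(i+1), cut down in degree 0 to the kernel of
   the map to W_0; it resolves K and maps to Z by m. *)
Lemma ex_fiber : exists (N : resolution K) (n : rmap (idm K) N Z)
    (j : forall i, hom (N i) (G i)),
  (forall i, n i = m i ∘ j i) /\ forall i, D i ∘ j i.+1 = j i ∘ rdif N i.
Proof.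
have [N0 [j0 kerj]] := ex_kernel abC c; have j0m := is_kernel_mono kerj.
have cj : a 0 ∘ (pl ∘ j0) = rdif W 0 ∘ (pr ∘ j0).
  by apply/eqP; rewrite -subr_eq0 !compA -compBl kerj.1.
have [d0 jd0] := kernel_lift kerj fiber_cD.
pose N i : C := if i is i'.+1 then G i'.+1 else N0.
pose j i : hom (N i) (G i) := match i with 0 => j0 | i'.+1 => idm _ end.
pose d i : hom (N i.+1) (N i) := match i with 0 => d0 | i'.+1 => D i'.+1 end.
have Dj i : D i ∘ j i.+1 = j i ∘ d i.
  by case: i => [|i] /=; rewrite compm1 ?comp1m.
have jm i : mono (j i) by case: i => [|i]; [exact: j0m | exact: mono_id].
(* [g] is the augmentation of the fibre. By [kg] it is the restriction of the augmentation of U, so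
   exactness of U can be used although the values are in K. *)
pose g : hom N0 K := raug Z ∘ (m 0 ∘ j0).
have kg : k ∘ g = raug U ∘ (pl ∘ j0).
  rewrite -fiber_aug /g /m !compDl !compDr addrC; congr (_ + _);
    last by rewrite !compA.
  by rewrite -(compA t0) cj !compA cone_t0.
have ge : epi g.
  have [X1 [e1 [v [ee1 ve]]]] := epi_lift abC k (raug_epi U).
  have [|X2 [e2 [w [ee2 we]]]] := (raug_exact W).2 _ (a 0 ∘ v).
    rewrite -(cone_t_aug t) -compA; apply/eqP.
    rewrite -(addr0 (q ∘ _)) -[X in _ + X](comp0m _ (raug Z ∘ (b 0 ∘ v))).
    rewrite -kq.1.1 -compA [k ∘ (_ ∘ _)]compA -compDr !compA -compDl.
    by rewrite fiber_aug ve compA kq.1.1 comp0m.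
  have [|x jx] := kernel_lift (h := pair_ abC (v ∘ e2) w) kerj.
    by rewrite compBl -!compA prl_pair prr_pair we !compA subrr.
  apply: (epi_of_lift (x := x) (epi_comp ee1 ee2)); apply: km.
  by rewrite compA kg -!compA jx prl_pair compA ve !compA.
have gx : exact_gen (d 0%N) g.
  split=> [|X y gy].
    apply: (mono0 km); rewrite compA kg -!compA jd0 prl_pair compA raug_dif.
    by rewrite comp0m.
  have [|X1 [e1 [v [ee1 ve]]]] := (raug_exact U).2 _ (pl ∘ (j0 ∘ y)).
    by rewrite !compA -[raug U ∘ pl ∘ j0]compA -kg -compA gy compm0.
  have [|X2 [e2 [x [ee2 xe]]]] := fiber_lift ee1 _ ve.
    by rewrite !compA -[a 0 ∘ pl ∘ j0]compA cj !compA.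
  exists X2, e2, x; split=> //; apply: j0m.
  by rewrite !compA /= jd0 xe.
have dx i : exact_gen (d i.+1) (d i).
  split=> [|X y dy].
    by apply: (mono0 (jm i)); rewrite compA -Dj /= compm1 fiber_DD.
  have Dy : D i ∘ y = 0.
    by rewrite -[D i]compm1 [D i ∘ _](Dj i) -compA dy compm0.
  have [|X1 [e1 [v [ee1 ve]]]] := (rdif_exact U i).2 _ (pl ∘ y).
    by rewrite -[LHS](prl_pair abC _ ((rdif W i.+1 ∘ pr - a i.+1 ∘ pl) ∘ y))
       compA -pair_comp Dy compm0.
  apply: (fiber_lift ee1 _ ve).
  apply/esym/eqP; rewrite -subr_eq0 !compA -compBl; apply/eqP.
  by rewrite -[LHS](prr_pair abC (rdif U i ∘ pl ∘ y)) -pair_comp Dy compm0.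
have bN : exists M, forall i, (M < i)%N -> idm (N i) = 0.
  have [M MP] := robj_bounded U; have [M' MP'] := robj_bounded W.
  exists (maxn M M') => -[//|i]; rewrite gtn_max => /andP[/MP idU /leqW/MP'
    idW] /=.
  rewrite -(bip_id (bip_objP abC _ _)).
  rewrite -[inl_ _ _ _]compm1 idU compm0 comp0m add0r.
  by rewrite -[inr_ _ _ _]compm1 idW compm0 comp0m.
have n_aug : raug Z ∘ (m 0 ∘ j 0%N) = idm K ∘ g by rewrite comp1m.
have n_dif i : rdif Z i ∘ (m i.+1 ∘ j i.+1) = (m i ∘ j i) ∘ d i.
  by rewrite compA -fiber_mD -!compA Dj.
pose NR := Resolution ge gx dx bN.
by exists NR, (@RMap _ _ _ (idm K) NR Z (fun i => m i ∘ j i) n_aug n_dif), j.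
Qed.

End Fiber.

(** A cocycle [f] on Z is a cocycle one degree higher on the splice, where it becomes the coboundary
    of some [s] on W. Then [(s, f)] is a cocycle on the cone, which resolves E, and becomes the
    coboundary of some [r] on a refinement U. On the fibre of U → W, which refines Z, the pair
    [(r, s)] cobounds [f]. *)
Lemma ext_null_kernel (C : preadditive) (abC : abelian_category C) m
    (K E Q Y : C) (k : hom K E) (q : hom E Q) :
  short_exact k q -> ext_null m E Y -> ext_null m.+1 Q Y -> ext_null m K Y.
Proof.
move=> kq extE extQ Z f fd.
have [W [t [s ts]]] := extQ (splice abC kq Z) f fd.
pose V := cone t.
have [|U [u [r ur]]] := extE V (s ∘ prl abC _ _ + f ∘ prr abC _ _).
  rewrite compDl -!compA prl_pair prr_pair compmN compDr !compA fd comp0m addr0.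
  by rewrite [_ ∘ t m.+2]ts addNr.
pose a i : hom (U i) (W i) := prl abC (W i) (Z i) ∘ u i.
pose b i : hom (U i) (Z i) := prr abC (W i) (Z i) ∘ u i.
have h_aug : (t 0%N : hom (W 0%N) E) ∘ a 0%N + k ∘ raug Z ∘ b 0%N = raug U.
  by have := rmor_aug u; rewrite comp1m /= /cone_aug compDl -!compA.
have ha i : a i ∘ rdif U i = - (rdif W i ∘ a i.+1).
  by rewrite /a -compA -(rmor_dif u) /= /cone_dif !compA prl_pair compNm.
have hb i : b i ∘ rdif U i =
    (t i.+1 : hom (W i.+1) (Z i)) ∘ a i.+1 + rdif Z i ∘ b i.+1.
  by rewrite /b -compA -(rmor_dif u) /= /cone_dif !compA prr_pair compDl
    -!compA.
have [N [n [j [nm Dj]]]] := ex_fiber h_aug ha hb.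
exists N, n, ((r ∘ prl abC _ _ + s ∘ prr abC _ _) ∘ j m).
rewrite -[RHS]compA -Dj nm !compA; congr (_ ∘ _).
rewrite compDl -!compA prl_pair prr_pair compBr !compA -ur.
rewrite !compDl compDr !compA ts -!compA.
by rewrite [RHS]addrC [RHS]addrA subrK addrC.
Qed.

(** * Comparison with the bounded derived category *)

Section MoreAbelian.
Variable C : preadditive.
Hypothesis abC : abelian_category C.

Lemma gen_of_coker (X Y Q : C) (f : hom X Y) (q : hom Y Q) :
  is_coker f q -> exact_gen f q.
Proof.
move=> cokq; have [I [i keri]] := ex_kernel abC q.
have [p [pe ip]] := image_factor abC cokq keri.
split=> [|V y qy]; first exact: cokq.1.
have [u iu] := kernel_lift keri qy.
have [V' [e [x [ee px]]]] := epi_lift abC u pe.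
by exists V', e, x; rewrite -ip -compA px compA iu.
Qed.

Lemma mono_epi_iso (X Y : C) (f : hom X Y) : mono f -> epi f -> is_iso f.
Proof.
move=> fm fe; have [Q [q cokq]] := ex_coker abC f.
have kerf := mono_kernel_coker abC fm cokq.
have q0 : q = 0 by apply: (epi0 fe); exact: cokq.1.
have [g fg] : exists g, f ∘ g = idm Y.
  by apply: (kernel_lift kerf); rewrite q0 comp0m.
by exists g; split=> //; apply: fm; rewrite compA fg comp1m compm1.
Qed.

Lemma idm0_hom (X Y : C) (f : hom X Y) : idm X = 0 -> f = 0.
Proof. by move=> X0; rewrite -(compm1 f) X0 compm0. Qed.

Lemma iso_idm0 (X Y : C) (f : hom X Y) : idm X = 0 -> idm Y = 0 -> is_iso f.
Proof. by move=> X0 Y0; exists 0; rewrite comp0m compm0 X0 Y0. Qed.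

Lemma cohomology_intro (X : complex C) (a i c : int) (K H : C)
    (k : hom K (X i)) (b : hom (X a) K) (p : hom K H) :
  a + 1 = i -> i + 1 = c -> is_kernel (cdiff X i c) k -> k ∘ b = cdiff X a i ->
  is_coker b p -> is_cohomology k p.
Proof.
move=> ai ic; have {ai} ai : a = i - 1 by rewrite -ai addrK.
by subst a c => kerk kb cokp; split=> //; exists b.
Qed.

Lemma cohomology_elim (X : complex C) (a i c : int) (K H : C)
    (k : hom K (X i)) (p : hom K H) :
  a + 1 = i -> i + 1 = c -> is_cohomology k p -> is_kernel (cdiff X i c) k /\
  exists b : hom (X a) K, k ∘ b = cdiff X a i /\ is_coker b p.
Proof.
move=> ai ic; have {ai} ai : a = i - 1 by rewrite -ai addrK.
by subst a c.
Qed.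

Lemma cohomology_idm0 (X : complex C) i (K H : C) (k : hom K (X i)) (p : hom K
  H) :
  idm (X i) = 0 -> is_cohomology k p -> idm H = 0.
Proof.
move=> X0 [kerk [b [_ cokp]]]; apply: (epi0 (is_coker_epi cokp)).
rewrite comp1m; apply: idm0_hom; apply: (mono0 (is_kernel_mono kerk)).
by rewrite compm1 -(comp1m k) X0 comp0m.
Qed.

End MoreAbelian.

Lemma NegzS j : Negz j.+1 + 1 = Negz j.
Proof. by rewrite !NegzE -[j.+2]addn1 PoszD opprD subrK. Qed.

(** * Resolutions as complexes indexed by the integers *)

Section Matrices.
Variable C : preadditive.

(* Recursion on both indices gives the differential as a matrix without any
   transport along equalities between degrees. *)
Fixpoint dmat (O : nat -> C) (d : forall i, hom (O i.+1) (O i)) (i j : nat) :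
    hom (O i) (O j) :=
  match i, j return hom (O i) (O j) with
  | 1, 0 => d 0%N
  | i'.+1, j'.+1 => dmat (fun n => d n.+1) i' j'
  | _, _ => 0
  end.

Lemma dmatS (O : nat -> C) (d : forall i, hom (O i.+1) (O i)) i :
  dmat d i.+1 i = d i.
Proof. by elim: i O d => //= i IH O d; apply: (IH (fun n => O n.+1)). Qed.

Lemma dmat0 (O : nat -> C) (d : forall i, hom (O i.+1) (O i)) i j :
  i != j.+1 -> dmat d i j = 0.
Proof.
elim: j O d i => [|j IH] O d [|[|i]] //= ij; apply: (IH (fun n => O n.+1)) =>
  //.
Qed.

(** The morphism [f] out of degree n, extended by zero to all degrees; the recursion on both indices
    serves the same purpose as in [dmat]. *)
Fixpoint colmat (O : nat -> C) (Y : C) (n : nat) :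
    hom (O n) Y -> forall j, hom (O j) Y :=
  match n return hom (O n) Y -> forall j, hom (O j) Y with
  | 0 => fun f j => match j return hom (O j) Y with 0 => f | _ => 0 end
  | n'.+1 => fun f j => match j return hom (O j) Y with
      | 0 => 0 | j'.+1 => @colmat (fun i => O i.+1) Y n' f j' end
  end.

Lemma colmatE (O : nat -> C) (Y : C) n (f : hom (O n) Y) : colmat f n = f.
Proof. by elim: n O f => //= n IH O f; apply: (IH (fun i => O i.+1)). Qed.

Lemma colmat0 (O : nat -> C) (Y : C) n (f : hom (O n) Y) j :
  j != n -> colmat f j = 0.
Proof.
elim: n O f j => [|n IH] O f [|j] //= jn; exact: (IH (fun i => O i.+1)).
Qed.

#[global] Arguments dmat : simpl never.
#[global] Arguments colmat : simpl never.

Definition stalk_in (Y : C) (i : int) : hom Y (stalk_obj Y i) :=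
  match i == 0 as b return hom Y (if b then Y else zob) with
  | true => idm Y | false => 0 end.

Definition stalk_out (Y : C) (i : int) : hom (stalk_obj Y i) Y :=
  match i == 0 as b return hom (if b then Y else zob) Y with
  | true => idm Y | false => 0 end.

Lemma stalk_inK (Y : C) i : i = 0 -> stalk_out Y i ∘ stalk_in Y i = idm Y.
Proof. by move->; apply: comp1m. Qed.

Lemma stalk_outK (Y : C) i : stalk_in Y i ∘ stalk_out Y i = idm _.
Proof.
rewrite /stalk_in /stalk_out /stalk_obj; case: (i == 0); first exact: comp1m.
by rewrite comp0m zobP.
Qed.

Lemma stalk_zob (Y : C) i : i != 0 -> idm (stalk_obj Y i) = 0.
Proof. by rewrite /stalk_obj => /negPf ->; apply: zobP. Qed.

Section Complex.
Variables (X : C) (Z : resolution X).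

(* Z_k is placed in degree -k; recall that Negz k is -(k + 1). *)
Definition cx_obj (i : int) : C :=
  match i with Posz 0 => Z 0%N | Posz _.+1 => zob | Negz k => Z k.+1 end.

Definition cx_dif (i j : int) : hom (cx_obj i) (cx_obj j) :=
  match i, j return hom (cx_obj i) (cx_obj j) with
  | Negz k, Posz 0 => dmat (rdif Z) k.+1 0
  | Negz k, Negz l => dmat (rdif Z) k.+1 l.+1
  | _, _ => 0
  end.

Lemma cx_shape i j : j != i + 1 -> cx_dif i j = 0.
Proof.
case: i j => [[|i]|i] [[|j]|j] // ij; apply: dmat0; apply: contraNN ij.
  by move/eqP=> [->].
by move/eqP=> [->]; rewrite NegzS.
Qed.

Lemma dmat_comp i j k : dmat (rdif Z) j k ∘ dmat (rdif Z) i j = 0.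
Proof.
have [->|ij] := eqVneq i j.+1; last by rewrite (dmat0 _ ij) compm0.
have [->|jk] := eqVneq j k.+1; last by rewrite (dmat0 _ jk) comp0m.
by rewrite !dmatS rdif2.
Qed.

Lemma cx_dif2 i j k : cx_dif j k ∘ cx_dif i j = 0.
Proof.
by case: i j k => [[|i]|i] [[|j]|j] [[|k]|k]; rewrite ?comp0m ?compm0 //;
   apply: dmat_comp.
Qed.

Definition cx : complex C := Complex cx_shape cx_dif2.

Lemma cx_bounded : bounded cx.
Proof.
have [N NP] := robj_bounded Z; exists N => -[[|i]|i] //= Ni; first exact: zobP.
exact: NP.
Qed.

(** Supported in degree -n. For a cocycle it yields a chain map to a shifted stalk complex; for an
    arbitrary cochain it supplies the entries of a homotopy. *)
Definition col (Y : C) n (f : hom (Z n) Y) (i : int) : hom (cx i) Y :=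
  match i return hom (cx_obj i) Y with
  | Posz 0 => colmat f 0 | Posz _.+1 => 0 | Negz k => colmat f k.+1 end.

Lemma col_dif (Y : C) n (f : hom (Z n) Y) i j :
  f ∘ rdif Z n = 0 -> col f j ∘ cdiff cx i j = 0.
Proof.
move=> fd; case: i j => [[|i]|i] [[|j]|j] //=; rewrite ?compm0 ?comp0m //.
  have [n0|n0] := eqVneq 0%N n; last by rewrite colmat0 ?comp0m.
  case: n / n0 f fd => f fd; rewrite colmatE.
  by have [->|i0] := eqVneq i 0%N; rewrite ?dmatS // (@dmat0 _ _ i.+1) ?compm0.
have [jn|jn] := eqVneq j.+1 n; last by rewrite colmat0 ?comp0m.
case: n / jn f fd => f fd; rewrite colmatE.
have [->|ij] := eqVneq i j.+1; first by rewrite dmatS.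
by rewrite (@dmat0 _ _ i.+1) ?compm0.
Qed.

End Complex.
End Matrices.

Section Roofs.
Variable C : preadditive.
Hypothesis abC : abelian_category C.

(** In degree 0 the cohomology is the cokernel of [rdif Z 0], which the augmentation identifies with
    X; in negative degrees it vanishes by exactness of Z, and in positive degrees both complexes are
    zero. The presentations of the cohomology are arbitrary, so isomorphisms with the expected ones
    have to be produced. *)
Lemma cx_quasi_iso (X : C) (Z : resolution X) (b : cmap (cx Z) (stalk X)) :
  b 0 = raug Z -> quasi_iso b.
Proof.
move=> b0 i K H K' H' k p k' p' u h cohZ cohX k'u hp.
case: i k k' cohZ cohX k'u => [[|i]|i] k k' cohZ cohX k'u.
- have [kerk [d [kd cokp]]] := cohomology_elim (a := Negz 0) (c := 1) erefl
  erefl cohZ.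
  have [kerk' [d' [kd' cokp']]] := cohomology_elim (a := Negz 0) (c := 1) erefl
    erefl cohX.
  have km := is_kernel_mono kerk; have km' := is_kernel_mono kerk'.
  (* Both outgoing differentials end in a zero object, so [k] and [k'] are isomorphisms; [v] and
     [v'] are their inverses. *)
  have [v kv] := kernel_lift kerk (to_zob (_ ∘ idm _) 0).
  have [v' kv'] := kernel_lift kerk' (to_zob (_ ∘ idm _) 0).
  have v'k' : v' ∘ k' = idm K' by apply: km'; rewrite compA kv' comp1m compm1.
  have vk : v ∘ k = idm K by apply: km; rewrite compA kv comp1m compm1.
  have d'0 : d' = 0 by apply: (mono0 km'); rewrite kd'.
  have p'm (V : C) (y : hom V K') : p' ∘ y = 0 -> y = 0.
    have [g gp'] := coker_lift (h := idm K') cokp'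
      (etrans (congr1 _ d'0) (compm0 _ _)).
    by move=> p'y; rewrite -(comp1m y) -gp' -compA p'y compm0.
  have uE : u = v' ∘ raug Z ∘ k.
    by rewrite -(comp1m u) -v'k' -[v' ∘ k' ∘ u]compA k'u b0 compA.
  apply: (mono_epi_iso abC).
    suff hm (V : C) (y : hom V H) : h ∘ y = 0 -> y = 0.
      move=> V a1 a2 e; apply/eqP; rewrite -subr_eq0; apply/eqP/hm.
      by rewrite compBr e subrr.
    move=> hy; have [V1 [e1 [x [ee1 px]]]] := epi_lift abC y (is_coker_epi
      cokp).
    have ux : u ∘ x = 0.
      by apply: p'm; rewrite compA -hp -compA px compA hy comp0m.
    have [|V2 [e2 [z [ee2 dz]]]] := (raug_exact Z).2 _ (k ∘ x).
      by rewrite -b0 compA -k'u -compA ux compm0.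
    apply: (epi0 (epi_comp ee1 ee2)).
    rewrite compA -px -compA -(comp1m (x ∘ e2)) -vk.
    rewrite -compA [k ∘ _]compA -dz.
    have -> : rdif Z 0 = k ∘ d by rewrite kd.
    by rewrite -[_ ∘ z]compA [v ∘ _]compA vk comp1m compA cokp.1 comp0m.
  have ue : epi u.
    rewrite uE; have v'e : epi v'.
      by move=> V a1 a2 /(congr1 (fun g => g ∘ k'));
        rewrite -!compA v'k' !compm1.
    apply: epi_comp; first by apply: epi_comp v'e (raug_epi Z).
    by move=> V a1 a2 /(congr1 (fun g => g ∘ v)); rewrite -!compA kv !compm1.
  move=> V a1 a2 /(congr1 (fun g => g ∘ p)).
  rewrite -!compA hp !compA => /ue; exact: (is_coker_epi cokp').
- by apply: iso_idm0; [apply: (cohomology_idm0 _ cohZ)|apply: (cohomology_idm0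
  _ cohX)];
    apply: zobP.
- apply: iso_idm0; last by apply: (cohomology_idm0 _ cohX); apply: zobP.
  (* The degree after [Negz i] is [0] for [i = 0] and a [Negz] otherwise; naming it [c] treats both
     cases together. *)
  have [c [ic dk]] : exists c, Negz i + 1 = c /\
      (cdiff (cx Z) (Negz i) c ∘ k = 0 -> rdif Z i ∘ k = 0).
    case: i k {k' cohZ cohX k'u} => [|i] k; first by exists 0.
    exists (Negz i); by rewrite NegzS; split=> //=; rewrite dmatS.
  have [kerk [d [kd cokp]]] := cohomology_elim (NegzS i) ic cohZ.
  apply: (epi0 (is_coker_epi cokp)); rewrite comp1m.
  have [V1 [e1 [x [ee1 dx]]]] := (rdif_exact Z i).2 _ _ (dk kerk.1).
  have dE : k ∘ d = rdif Z i.+1 by rewrite kd /= dmatS.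
  apply: (epi0 ee1).
  rewrite -(comp1m e1) -[_ ∘ (_ ∘ _)]/(p ∘ (idm K ∘ e1)).
  suff -> : idm K ∘ e1 = d ∘ x by rewrite compA cokp.1 comp0m.
  by apply: (is_kernel_mono kerk); rewrite comp1m compA dE dx.
Qed.

(** * Truncating the apex of a roof to a resolution *)

Section Truncation.
Variables (X : C) (W : complex C) (b : cmap W (stalk X)).
Hypotheses (bW : bounded W) (qb : quasi_iso b).
Variables (K : C) (w : hom K (W 0)) (d : hom (W (Negz 0)) K).
Hypotheses (kerw : is_kernel (cdiff W 0 1) w) (wd : w ∘ d = cdiff W (Negz 0) 0).

Let wm : mono w := is_kernel_mono kerw.

(** The canonical truncation to degrees at most 0: the term in degree 0 is the object K of cocycles
    rather than [W 0], so that the cohomology in degree 0 is kept. *)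
Definition trunc_obj (i : nat) : C := if i is j.+1 then W (Negz j) else K.

Definition trunc_dif i : hom (trunc_obj i.+1) (trunc_obj i) :=
  match i with 0 => d | j.+1 => cdiff W (Negz j.+1) (Negz j) end.

Definition trunc_aug : hom K X := b 0 ∘ w.

(** The stalk complex has cohomology X in degree 0, presented by identities, so the
    quasi-isomorphism [b] makes the induced map [h] invertible. *)
Lemma trunc_cohomology0 : exists (H : C) (p : hom K H) (h : hom H X),
  is_coker d p /\ is_iso h /\ h ∘ p = trunc_aug.
Proof.
have [H [p cokp]] := ex_coker abC d.
have augd : trunc_aug ∘ d = 0.
  by rewrite -compA wd (cmorC b) comp0m.
have [h hp] := coker_lift cokp augd.
exists H, p, h; split=> //; split=> //.
have cohW : is_cohomology w p.
  exact: (cohomology_intro (a := Negz 0) (c := 1) erefl erefl kerw wd cokp).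
have cohX : is_cohomology (idm X : hom X (stalk X 0)) (idm X).
  apply: (@cohomology_intro _ (stalk X) (Negz 0) 0 1 _ _ _ 0) => //.
  - apply: intro_kernel => [||V g _]; [exact: comp0m | exact: mono_id | ].
    by exists g; rewrite comp1m.
  - by rewrite compm0.
  - apply: intro_coker => [||V g _]; [exact: compm0 | exact: epi_id | ].
    by exists g; rewrite compm1.
by apply: (qb cohW cohX (u := trunc_aug)); rewrite ?comp1m.
Qed.

Lemma trunc_aug_epi : epi trunc_aug.
Proof.
have [H [p [h [cokp [[g [gh hg]] <-]]]]] := trunc_cohomology0.
apply: epi_comp (is_coker_epi cokp) => V a1 a2 /(congr1 (fun f => f ∘ g)).
by rewrite -!compA hg !compm1.
Qed.

Lemma trunc_aug_exact : exact_gen d trunc_aug.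
Proof.
have [H [p [h [cokp [[g [gh hg]] <-]]]]] := trunc_cohomology0.
split=> [|V y hpy]; first by rewrite -compA cokp.1 compm0.
apply: (gen_of_coker abC cokp).2.
by rewrite -(comp1m (p ∘ y)) -gh -!compA [h ∘ _]compA hpy compm0.
Qed.

Lemma trunc_dif_exact i : exact_gen (trunc_dif i.+1) (trunc_dif i).
Proof.
have [c [ic [dc dk]]] : exists c, Negz i + 1 = c /\
    (trunc_dif i ∘ trunc_dif i.+1 = 0 /\
     forall V (y : hom V (W (Negz i))), trunc_dif i ∘ y = 0 ->
       cdiff W (Negz i) c ∘ y = 0).
  case: i => [|i].
    exists 0; split=> //; split=> [|V y /= dy].
      by apply: (mono0 wm); rewrite compA wd cdiff2.
    by rewrite -wd -compA dy compm0.
  by exists (Negz i); rewrite NegzS; split=> //; rewrite /= cdiff2.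
split=> // V y /dk cy.
have [K' [k kerk]] := ex_kernel abC (cdiff W (Negz i) c).
have [a ka] := kernel_lift kerk (cdiff2 W (Negz i.+1) _ _).
have [H [p cokp]] := ex_coker abC a.
have cohW := cohomology_intro (NegzS i) ic kerk ka cokp.
have [k' kk'] := kernel_lift kerk cy.
have cohX : is_cohomology (idm zob : hom zob (stalk X (Negz i))) (idm zob).
  apply: (@cohomology_intro _ (stalk X) (Negz i.+1) (Negz i) c _ _ _ 0) => //.
  - exact: NegzS.
  - apply: intro_kernel => [||U g _]; [exact: comp0m | exact: mono_id | ].
    by exists g; rewrite comp1m.
  - by rewrite compm0.
  - apply: intro_coker => [||U g _]; [exact: compm0 | exact: epi_id | ].
    by exists g; rewrite compm1.
(* The cohomology of the stalk complex is zero here, and an isomorphism from H to the zero object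
   gives [idm H = 0]: every cocycle is locally a boundary. *)
have [|| g [gh _]] := qb cohW cohX (u := 0) (h := 0).
- exact: to_zob.
- exact: to_zob.
have [V' [e [x [ee ax]]]] : exists (V' : C) (e : hom V' V) (x : hom V' (W (Negz
  i.+1))),
    epi e /\ a ∘ x = k' ∘ e.
  apply: (gen_of_coker abC cokp).2.
  by rewrite -(comp1m (p ∘ k')) -gh compm0 comp0m.
exists V', e, x; split=> //.
by rewrite -kk' -compA -ax compA ka.
Qed.

Lemma trunc_bounded : exists N, forall i, (N < i)%N -> idm (trunc_obj i) = 0.
Proof.
have [N NP] := bW; exists N => -[//|i] Ni; apply: NP; exact: Ni.
Qed.

Definition trunc : resolution X :=
  Resolution trunc_aug_epi trunc_aug_exact trunc_dif_exact trunc_bounded.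

End Truncation.

Lemma ex_trunc (W : complex C) :
  exists (K : C) (w : hom K (W 0)) (d : hom (W (Negz 0)) K),
  is_kernel (cdiff W 0 1) w /\ w ∘ d = cdiff W (Negz 0) 0.
Proof.
have [K [w kerw]] := ex_kernel abC (cdiff W 0 1).
have [d wd] := kernel_lift kerw (cdiff2 W (Negz 0) 0 1).
by exists K, w, d.
Qed.

End Roofs.

(** * Vanishing of roofs and vanishing on refinements *)

Section Conversion.
Variable C : preadditive.
Hypothesis abC : abelian_category C.

Lemma shift_stalk_dif (Y : C) n i j : cdiff (shift n (stalk Y)) i j = 0.
Proof. by rewrite /= /shift_diff /= oppr0 if_same. Qed.

Lemma to_stalk_eq (X Y : C) i (f g : hom X (stalk_obj Y i)) :
  stalk_out Y i ∘ f = stalk_out Y i ∘ g -> f = g.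
Proof.
move=> e; rewrite -(comp1m f) -(comp1m g) -(stalk_outK Y i).
by rewrite -!compA e.
Qed.

Lemma to_stalk0 (X Y : C) i (f g : hom X (stalk_obj Y i)) : i != 0 -> f = g.
Proof.
by move=> /(stalk_zob Y) i0; rewrite -(comp1m f) -(comp1m g) i0 !comp0m.
Qed.

Lemma Negz_shift m : Negz m + m.+1%:Z = 0.
Proof. by rewrite NegzE addNr. Qed.

(** The case that matters is [m = 0]: the truncated differential ends in K instead of [W 0], and a
    cochain on [W 0] is restricted along [w]. *)
Lemma trunc_cochain (X : C) (W : complex C) (b : cmap W (stalk X))
    (bW : bounded W) (qb : quasi_iso b) (K : C) (w : hom K (W 0))
    (d : hom (W (Negz 0)) K) (kerw : is_kernel (cdiff W 0 1) w)
    (wd : w ∘ d = cdiff W (Negz 0) 0) m (Y : C) (f : hom (W (Negz m)) Y) :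
  (forall c, c = Negz m + 1 ->
    exists s : hom (W c) Y, f = s ∘ cdiff W (Negz m) c) ->
  exists v, f = v ∘ rdif (trunc abC bW qb kerw wd) m.
Proof.
case: m f => [|m] f sP /=.
  by have [s ->] := sP 0 erefl; exists (s ∘ w); rewrite -wd compA.
by have [s ->] := sP (Negz m) (esym (NegzS m)); exists s.
Qed.

Lemma col_cdiff (X Y : C) (Z : resolution X) m (s : hom (Z m) Y) c :
  c = Negz m + 1 -> col s c ∘ cdiff (cx Z) (Negz m) c = s ∘ rdif Z m.
Proof.
case: m s => [|m] s; first by move=> ->; rewrite /= colmatE dmatS.
by rewrite NegzS => ->; rewrite /= colmatE dmatS.
Qed.

(** The cocycle gives a roof with apex [cx Z]. The truncation of the complex W that witnesses its
    vanishing refines Z. The target has zero differential, so in degree -(m + 1) the homotopy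
    exhibits [f ∘ t] as a coboundary. *)
Lemma Ext_ext_null m (X Y : C) : Ext_vanishes m.+1 X Y -> ext_null m X Y.
Proof.
move=> ext Z f fd.
pose bm i : hom (cx Z i) (stalk X i) :=
  match i return hom (cx_obj Z i) (stalk_obj X i) with
  | Posz 0 => raug Z | _ => 0 end.
have bC i j : bm j ∘ cdiff (cx Z) i j = cdiff (stalk X) i j ∘ bm i.
  rewrite comp0m; case: i j => [[|i]|i] [[|j]|j] //=;
    rewrite ?comp0m ?compm0 //.
  have [->|i0] := eqVneq i 0%N; first by rewrite dmatS raug_dif.
  by rewrite (@dmat0 _ _ _ i.+1) // compm0.
pose b := CMap bC.
have qb : quasi_iso b by apply: cx_quasi_iso.
pose gm i : hom (cx Z i) (shift m.+1 (stalk Y) i) := stalk_in Y _ ∘ col f i.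
have gC i j : gm j ∘ cdiff (cx Z) i j = cdiff (shift m.+1 (stalk Y)) i j ∘ gm i.
  by rewrite shift_stalk_dif comp0m -compA col_dif // compm0.
have [W [t [t' [bW qbt _ [h hP]]]]] := ext (Roof (cx_bounded Z) qb (CMap gC)).
have [K [w [d [kerw wd]]]] := ex_trunc abC W.
pose Z' := trunc abC bW qbt kerw wd.
pose u i : hom (Z' i) (Z i) :=
  match i with 0 => t 0 ∘ w | j.+1 => t (Negz j) end.
have u_aug : raug Z ∘ u 0%N = idm X ∘ raug Z' by rewrite comp1m /= compA.
have u_dif i : rdif Z i ∘ u i.+1 = u i ∘ rdif Z' i.
  case: i => [|i] /=.
    by rewrite -compA wd (cmorC t) /= dmatS.
  by rewrite (cmorC t) /= dmatS.
have [|v vP] := trunc_cochain bW qbt kerw wd (f := f ∘ t (Negz m)).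
  move=> c ->; exists (stalk_out Y _ ∘ h _ (Negz m)).
  have := hP (Negz m); rewrite shift_stalk_dif comp0m add0r.
  rewrite [X in X - _]/= /gm [X in _ - X]comp0m subr0.
  move=> /(congr1 (fun g => stalk_out Y _ ∘ g)).
  rewrite !compA stalk_inK ?Negz_shift // comp1m => <-.
  by rewrite /= colmatE.
by exists Z', (RMap u_aug u_dif), v.
Qed.

(** The truncated apex is a resolution, and the degree -(m + 1) component of the forward leg is a
    cocycle on it. A refinement on which it is a coboundary is the common apex, with the cobounding
    cochain as homotopy; in all other degrees the shifted stalk is zero. *)
Lemma ext_null_Ext m (X Y : C) : ext_null m X Y -> Ext_vanishes m.+1 X Y.
Proof.
move=> ext [W bW b qb g].
have [K [w [d [kerw wd]]]] := ex_trunc abC W.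
pose Z := trunc abC bW qb kerw wd.
have [|Z' [t [s ts]]] := ext Z (stalk_out Y _ ∘ g (Negz m)).
  rewrite -compA; set e := g _ ∘ _.
  have -> : e = g (Negz m) ∘ cdiff W (Negz m.+1) (Negz m) by [].
  by rewrite cmorC shift_stalk_dif comp0m compm0.
pose um i : hom (cx Z' i) (W i) :=
  match i return hom (cx_obj Z' i) (W i) with
  | Posz 0 => w ∘ t 0%N | Posz _.+1 => 0 | Negz k => t k.+1 end.
have uC i j : um j ∘ cdiff (cx Z') i j = cdiff W i j ∘ um i.
  have [->|ij] := eqVneq j (i + 1); last by rewrite !cdiff_shape // comp0m
    compm0.
  case: i => [[|i]|[|i]].
  - by rewrite /= comp0m compA kerw.1 comp0m.
  - by rewrite /= !compm0.
  - by rewrite /= dmatS -compA -(rmor_dif t) compA wd.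
  - by rewrite NegzS /= dmatS -(rmor_dif t).
pose u := CMap uC.
have qbu : quasi_iso (cmap_comp b u).
  by apply: cx_quasi_iso => //; rewrite /= compA -[RHS]comp1m -(rmor_aug t).
exists (cx Z'), u, (cmap_comp b u); split=> //; first exact: cx_bounded.
  by exists (fun i j => 0) => i /=; rewrite comp1m subrr !compm0 comp0m addr0.
exists (fun i j => stalk_in Y _ ∘ col s i) => i.
rewrite shift_stalk_dif comp0m add0r [X in _ - X]comp0m subr0.
have [->|im] := eqVneq i (Negz m); last first.
  by apply: to_stalk0; rewrite -(Negz_shift m) (inj_eq (addIr _)).
apply: to_stalk_eq; rewrite !compA stalk_inK ?Negz_shift // comp1m.
by rewrite col_cdiff //; apply: ts.
Qed.

Lemma Ext_vanishesP m (X Y : C) : Ext_vanishes m.+1 X Y <-> ext_null m X Y.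
Proof. by split; [apply: Ext_ext_null | apply: ext_null_Ext]. Qed.

End Conversion.

(** * Extending morphisms when the first Ext vanishes *)

Section Extension.
Variable C : preadditive.
Hypothesis abC : abelian_category C.

Definition id_obj (X : C) (i : nat) : C := if i is 0 then X else zob.

Lemma id_resolution_subproof (X : C) :
  exact_gen (0 : hom (id_obj X 1) X) (idm X) /\
  (forall i, exact_gen (0 : hom (id_obj X i.+2) (id_obj X i.+1))
                       (0 : hom (id_obj X i.+1) (id_obj X i))) /\
  exists N, forall i, (N < i)%N -> idm (id_obj X i) = 0.
Proof.
split; last split; last by exists 0%N => -[//|i] _; apply: zobP.
  split=> [|V y]; first by rewrite comp1m.
  rewrite comp1m => ->; exists V, (idm V), 0.
  by rewrite compm0 comp0m; split=> //; apply: epi_id.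
move=> i; split=> [|V y _]; first by rewrite comp0m.
exists V, (idm V), 0; split; [exact: epi_id | exact: to_zob].
Qed.

Definition id_resolution (X : C) : resolution X :=
  @Resolution C X (id_obj X) (idm X) (fun=> 0) (epi_id (X := X))
    (id_resolution_subproof X).1 (id_resolution_subproof X).2.1
    (id_resolution_subproof X).2.2.

(* On W_0 + B the map (s, f) kills the kernel of the epimorphism onto E. *)
Lemma ext_null0_extend (B E X Y : C) (k : hom B E) (e : hom E X) (f : hom B Y) :
  short_exact k e -> ext_null 0 X Y -> exists g : hom E Y, g ∘ k = f.
Proof.
move=> ke ext; have km := is_kernel_mono ke.1.
have fd : f ∘ rdif (splice abC ke (id_resolution B)) 1 = 0.
  exact: from_zob.
have [W [t [s ts]]] := ext (splice abC ke (id_resolution B)) f fd.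
pose t0 : hom (W 0%N) E := t 0%N; pose t1 : hom (W 1%N) B := t 1%N.
have t0_aug : e ∘ t0 = raug W by rewrite [LHS](rmor_aug t) comp1m.
have t0_dif : k ∘ t1 = t0 ∘ rdif W 0.
  by rewrite -(rmor_dif t 0) /= compm1.
pose c : hom (bip_obj abC (W 0%N) B) E := t0 ∘ prl abC _ _ + k ∘ prr abC _ _.
have ce : epi c.
  have [V [e1 [w [ee1 we]]]] := epi_lift abC e (raug_epi W).
  have [|y ky] := kernel_lift (h := e1 - t0 ∘ w) ke.1.
    by rewrite compBr compA t0_aug we subrr.
  apply: (epi_of_lift (x := pair_ abC w y) ee1).
  by rewrite compDl -!compA prl_pair prr_pair ky addrC subrK.
have [D [d kerd]] := ex_kernel abC c.
have [|g gc] := coker_lift (h := s ∘ prl abC _ _ + f ∘ prr abC _ _)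
    (epi_coker_kernel abC ce kerd).
  have cd : t0 ∘ (prl abC _ _ ∘ d) = - (k ∘ (prr abC _ _ ∘ d)).
    by apply/eqP; rewrite -addr_eq0 !compA -compDl kerd.1.
  have [|V [e1 [x [ee1 xe]]]] := (raug_exact W).2 _ (prl abC _ _ ∘ d).
    by rewrite -t0_aug -compA cd compmN compA ke.1.1 comp0m oppr0.
  apply: (epi0 ee1); rewrite !compDl -!compA [prl abC _ _ ∘ (d ∘ e1)]compA -xe.
  rewrite [s ∘ _]compA -ts -!compA -compDr.
  suff -> : t1 ∘ x + prr abC _ _ ∘ (d ∘ e1) = 0 by rewrite compm0.
  apply: (mono0 km); rewrite compDr compA t0_dif -compA xe [t0 ∘ _]compA cd.
  by rewrite compNm -!compA addNr.
exists g; have := congr1 (fun h => h ∘ pair_ abC 0 (idm B)) gc.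
rewrite -compA !compDl -!compA prl_pair prr_pair !compm1 !compm0 !add0r.
by [].
Qed.

End Extension.

(** * Cohen-Macaulay objects *)

Section Coinduction.
Variable C : preadditive.
Hypothesis abC : abelian_category C.
Variable omega : C -> Prop.

Lemma resolution_step (X : C) : has_resolution omega X ->
  exists (K W : C) (k : hom K W) (e : hom W X),
    [/\ short_exact k e, omega W, right_perp omega K & has_resolution omega K].
Proof.
move=> [T [d [e [oT ee ex0 exd [[K [k [kerk pK]]] kerd]]]]].
have [d0e _] := (exact_atP abC _ _).1 ex0.
have km := is_kernel_mono kerk.
have [e' ke'] := kernel_lift kerk d0e.
exists K, (T 0%N), k, e; split=> //; first exact: short_exact_kernel.
exists (fun n => T n.+1), (fun n => d n.+1), e'; split=> //; last split=> //.
- have [_ /(_ _ _ kerk.1)[V [v [x [ve dx]]]]] := (exact_atP abC _ _).1 ex0.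
  by apply: (epi_of_lift (x := x) ve); apply: km; rewrite compA ke' dx.
- apply/(exact_atP abC); have [d10 d10P] := (exact_atP abC _ _).1 (exd 0%N).
  split=> [|V y e'y]; first by apply: (mono0 km); rewrite compA ke'.
  by apply: d10P; rewrite -ke' -compA e'y compm0.
have [K' [k' [kerk' pK']]] := kerd 0%N; exists K', k'; split=> //.
by apply/(kernel_mono_comp e' k' km); rewrite ke'.
Qed.

(** Dependent choice: [cid] turns the hypothesis into a function on the objects satisfying [Q],
    which is iterated from X. The differentials are the composites [k n ∘ e n.+1] through the
    successive syzygies. *)
Lemma resolution_coind (Q : C -> Prop) :
  (forall X, Q X -> exists (K W : C) (k : hom K W) (e : hom W X),
    [/\ short_exact k e, omega W, right_perp omega K & Q K]) ->
  forall X, Q X -> has_resolution omega X.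
Proof.
move=> step X QX.
have st (s : {Y | Q Y}) : {K : {Y | Q Y} & {W : C &
    {m : hom (sval K) W * hom W (sval s) |
      [/\ short_exact m.1 m.2, omega W & right_perp omega (sval K)]}}}.
  have /cid[K /cid[W /cid[k /cid[e [ke oW pK QK]]]]] := step _ (svalP s).
  by exists (exist _ K QK), W, (k, e).
pose fix s n : {Y | Q Y} :=
  if n is n'.+1 then projT1 (st (s n')) else exist _ X QX.
pose T n : C := projT1 (projT2 (st (s n))).
pose k n : hom (sval (s n.+1)) (T n) := (sval (projT2 (projT2 (st (s n))))).1.
pose e n : hom (T n) (sval (s n)) := (sval (projT2 (projT2 (st (s n))))).2.
have P n : [/\ short_exact (k n) (e n), omega (T n) & right_perp omega (sval (s
  n.+1))].
  exact: (svalP (projT2 (projT2 (st (s n))))).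
have ke n : short_exact (k n) (e n) by case: (P n).
have km n : mono (k n) by apply: is_kernel_mono (ke n).1.
have ee n : epi (e n) by apply: is_coker_epi (ke n).2.
have exke n : exact_gen (k n ∘ e n.+1) (e n).
  split=> [|V y ey]; first by rewrite compA (ke n).1.1 comp0m.
  have [u ku] := kernel_lift (ke n).1 ey.
  have [V' [v [x [ve xE]]]] := epi_lift abC u (ee n.+1).
  by exists V', v, x; rewrite -compA xE compA ku.
exists T, (fun n => k n ∘ e n.+1), (e 0%N); split=> //.
- by move=> n; case: (P n).
- exact/(exact_atP abC).
- move=> n; apply/(exact_atP abC); have [ek0 ekP] := exke n.+1.
  split=> [|V y key]; first by rewrite -compA ek0 compm0.
  by apply: ekP; apply: (mono0 (km n)); rewrite compA.
split=> [|n]; first by exists (sval (s 1)), (k 0%N); split;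
  [exact: (ke 0%N).1 | case: (P 0%N)].
exists (sval (s n.+2)), (k n.+1); split; last by case: (P n.+1).
by apply/(kernel_mono_comp _ _ (km n)); exact: (ke n.+1).1.
Qed.

(** The coinductive predicate is the hypothesis itself: a resolution of K unfolds by
    [resolution_step] into the same data for K. *)
Lemma resolution_cons (X K W : C) (k : hom K W) (e : hom W X) :
  short_exact k e -> omega W -> right_perp omega K -> has_resolution omega K ->
  has_resolution omega X.
Proof.
move=> ke oW pK rK; pose Q Y := exists (K W : C) (k : hom K W) (e : hom W Y),
  [/\ short_exact k e, omega W, right_perp omega K & has_resolution omega K].
apply: (@resolution_coind Q) => [Y [K' [W' [k' [e' [ke' oW' pK'
  /resolution_step rK']]]]]|].
  by exists K', W', k', e'.
by exists K, W, k, e.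
Qed.

Lemma coresolution_step (X : C) : has_coresolution omega X ->
  exists (W Z : C) (m : hom X W) (q : hom W Z),
    [/\ short_exact m q, omega W, left_perp omega Z & has_coresolution omega Z].
Proof.
move=> [T [d [e [oT em ex0 exd [[Z [q [cokq pZ]]] cokd]]]]].
have [d0e d0eP] := (exact_atP abC _ _).1 ex0.
have qe := is_coker_epi cokq.
have [e' e'q] := coker_lift cokq d0e.
exists (T 0%N), Z, e, q; split=> //; first exact: short_exact_coker.
exists (fun n => T n.+1), (fun n => d n.+1), e'; split=> //; last split=> //.
- suff e'm (V : C) (y : hom V Z) : e' ∘ y = 0 -> y = 0.
    move=> V a b ab; apply/eqP; rewrite -subr_eq0; apply/eqP/e'm.
    by rewrite compBr ab subrr.
  move=> e'y; have [V1 [e1 [x [ee1 qx]]]] := epi_lift abC y qe.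
  have [|V2 [e2 [z [ee2 ez]]]] := d0eP _ x.
    by rewrite -e'q -compA qx compA e'y comp0m.
  apply: (epi0 (epi_comp ee1 ee2)); rewrite compA -qx -compA -ez.
  by rewrite compA cokq.1 comp0m.
- apply/(exact_atP abC); have [d10 d10P] := (exact_atP abC _ _).1 (exd 0%N).
  split=> [|V y dy]; first by apply: (epi0 qe); rewrite -compA e'q.
  have [V' [v [x [ve dx]]]] := d10P _ _ dy.
  by exists V', v, (q ∘ x); rewrite compA e'q.
have [Z' [q' [cokq' pZ']]] := cokd 0%N; exists Z', q'; split=> //.
by apply/(coker_epi_comp e' q' qe); rewrite e'q.
Qed.

Lemma coresolution_coind (Q : C -> Prop) :
  (forall X, Q X -> exists (W Z : C) (m : hom X W) (q : hom W Z),
    [/\ short_exact m q, omega W, left_perp omega Z & Q Z]) ->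
  forall X, Q X -> has_coresolution omega X.
Proof.
move=> step X QX.
have st (s : {Y | Q Y}) : {Z : {Y | Q Y} & {W : C &
    {f : hom (sval s) W * hom W (sval Z) |
      [/\ short_exact f.1 f.2, omega W & left_perp omega (sval Z)]}}}.
  have /cid[W /cid[Z /cid[m /cid[q [mq oW pZ QZ]]]]] := step _ (svalP s).
  by exists (exist _ Z QZ), W, (m, q).
pose fix s n : {Y | Q Y} :=
  if n is n'.+1 then projT1 (st (s n')) else exist _ X QX.
pose T n : C := projT1 (projT2 (st (s n))).
pose m n : hom (sval (s n)) (T n) := (sval (projT2 (projT2 (st (s n))))).1.
pose q n : hom (T n) (sval (s n.+1)) := (sval (projT2 (projT2 (st (s n))))).2.
have P n : [/\ short_exact (m n) (q n), omega (T n) & left_perp omega (sval (s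
  n.+1))].
  exact: (svalP (projT2 (projT2 (st (s n))))).
have mq n : short_exact (m n) (q n) by case: (P n).
have mm n : mono (m n) by apply: is_kernel_mono (mq n).1.
have qe n : epi (q n) by apply: is_coker_epi (mq n).2.
have exmq n (V : C) (y : hom V (T n)) : m n.+1 ∘ q n ∘ y = 0 ->
    exists u, m n ∘ u = y.
  move=> mqy; apply: (kernel_lift (mq n).1).
  by apply: (mono0 (mm n.+1)); rewrite compA.
exists T, (fun n => m n.+1 ∘ q n), (m 0%N); split=> //.
- by move=> n; case: (P n).
- exact: (mm 0%N).
- apply/(exact_atP abC).
  split=> [|V y /exmq[u mu]]; first by rewrite -compA (mq 0%N).1.1 compm0.
  by exists V, (idm V), u; rewrite compm1; split; first exact: epi_id.
- move=> n; apply/(exact_atP abC); split=> [|V y /exmq[u mu]].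
    by rewrite -compA [q n.+1 ∘ _]compA (mq n.+1).1.1 comp0m compm0.
  have [V' [v [x [ve qx]]]] := epi_lift abC u (qe n).
  by exists V', v, x; rewrite -compA qx compA mu.
split=> [|n].
  by exists (sval (s 1)), (q 0%N); split; [exact: (mq 0%N).2 | case: (P 0%N)].
exists (sval (s n.+2)), (q n.+1); split; last by case: (P n.+1).
by apply/(coker_epi_comp _ _ (qe n)); exact: (mq n.+1).2.
Qed.

Lemma coresolution_cons (X W Z : C) (m : hom X W) (q : hom W Z) :
  short_exact m q -> omega W -> left_perp omega Z -> has_coresolution omega Z ->
  has_coresolution omega X.
Proof.
move=> mq oW pZ rZ; pose Q Y := exists (W Z : C) (m : hom Y W) (q : hom W Z),
  [/\ short_exact m q, omega W, left_perp omega Z & has_coresolution omega Z].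
apply: (@coresolution_coind Q) => [Y [W' [Z' [m' [q' [mq' oW' pZ'
  /coresolution_step rZ']]]]]|].
  by exists W', Z', m', q'.
by exists W, Z, m, q.
Qed.

End Coinduction.

(** * Orthogonality and closure properties of Cohen-Macaulay objects *)

Section CohenMacaulay.
Variable C : preadditive.
Hypothesis abC : abelian_category C.
Variable omega : C -> Prop.
Hypotheses (omega_orth : self_orthogonal omega) (omega_zob : omega zob)
  (omega_bip : forall (X Y S : C) (i : hom X S) (j : hom Y S) (p : hom S X)
    (q : hom S Y), is_biproduct i j p q -> omega X -> omega Y -> omega S).

(** For the first step K → T → X, each Ext from W to X lies between Ext from W to T, zero by
    self-orthogonality, and the next Ext from W to K, zero by the condition on kernels. *)
Lemma resolution_right_perp (X : C) : has_resolution omega X -> right_perp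
  omega X.
Proof.
move=> /(resolution_step abC)[K [T [k [e [ke oT pK _]]]]] W oW [//|n] _.
apply/(Ext_vanishesP abC); apply: (ext_null_quotient abC ke).
  by apply/(Ext_vanishesP abC); apply: omega_orth.
by apply/(Ext_vanishesP abC); apply: pK.
Qed.

Lemma left_perp_kernel (X W Z : C) (m : hom X W) (q : hom W Z) :
  short_exact m q -> left_perp omega W -> left_perp omega Z -> left_perp omega
    X.
Proof.
move=> mq pW pZ Y oY [//|n] _; apply/(Ext_vanishesP abC).
by apply: (ext_null_kernel abC mq); apply/(Ext_vanishesP abC);
  [apply: pW | apply: pZ].
Qed.

Lemma omega_left_perp (W : C) : omega W -> left_perp omega W.
Proof. by move=> oW Y oY n; apply: omega_orth. Qed.

Lemma omega_right_perp (W : C) : omega W -> right_perp omega W.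
Proof. by move=> oW Y oY n; apply: omega_orth. Qed.

Lemma coresolution_left_perp (X : C) :
  has_coresolution omega X -> left_perp omega X.
Proof.
move=> /(coresolution_step abC)[W [Z [m [q [mq oW pZ _]]]]].
exact: left_perp_kernel mq (omega_left_perp oW) pZ.
Qed.

(** The cosyzygy Z gets its resolution from W → Z followed by that of X, whose right orthogonality
    is the kernel condition. This provides the injective embeddings of the Frobenius structure. *)
Lemma CM_step (X : C) : CM omega X -> exists (W Z : C) (m : hom X W) (q : hom W
  Z),
  [/\ short_exact m q, omega W & CM omega Z].
Proof.
move=> [/(coresolution_step abC)[W [Z [m [q [mq oW pZ cZ]]]]] rX].
exists W, Z, m, q; split=> //; split=> //.
exact: (resolution_cons abC mq oW (resolution_right_perp rX) rX).
Qed.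

Lemma short_exact_id_zob (P : C) : short_exact (idm P) (0 : hom P zob).
Proof.
apply: (short_exact_coker abC); first exact: mono_id.
apply: intro_coker => [|V a b _|V h]; first by rewrite comp0m.
  exact: from_zob.
by rewrite compm1 => ->; exists 0; rewrite compm0.
Qed.

Lemma omega_CM (W : C) : omega W -> CM omega W.
Proof.
move=> oW; split.
  apply: (coresolution_coind abC (Q := omega)) oW => Y oY.
  exists Y, zob, (idm Y), 0; split=> //; first exact: short_exact_id_zob.
  exact: omega_left_perp.
apply: (resolution_coind abC (Q := omega)) oW => Y oY.
exists zob, Y, 0, (idm Y); split=> //; first exact: short_exact_zob_id.
exact: omega_right_perp.
Qed.

Lemma suspension_inhabited : inhabited (suspension omega).
Proof.
have H (X : C) : exists (I S : C) (f : hom X I) (g : hom I S),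
    CM omega X -> omega I /\ conflation omega f g.
  have [cX|ncX] := pselect (CM omega X); last by exists X, X, 0, 0.
  have [W [Z [m [q [mq oW cZ]]]]] := CM_step cX.
  by exists W, Z, m, q; split=> //; split=> //; apply: omega_CM.
pose I X := projT1 (cid (H X)); have HI X := projT2 (cid (H X)).
pose S X := projT1 (cid (HI X)); have HS X := projT2 (cid (HI X)).
pose f X := projT1 (cid (HS X)); have Hf X := projT2 (cid (HS X)).
pose g X := projT1 (cid (Hf X)); have Hg X := projT2 (cid (Hf X)).
split; apply: (@Suspension _ omega I S f g) => X cX; first by case: (Hg X cX).
by case: (Hg X cX).
Qed.

(** W is added to the first term on either side: the embedding of X + W into T + W has the same
    cokernel as that of X, and T + W → X + W has the same kernel as T → X. *)
Lemma CM_bip (X W S : C) (i : hom X S) (j : hom W S) (p : hom S X) (q : hom S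
  W) :
  is_biproduct i j p q -> CM omega X -> omega W -> CM omega S.
Proof.
move=> bS [cX rX] oW; split.
  have [T [Z [m [c [mc oT pZ cZ]]]]] := coresolution_step abC cX.
  have [T' [i' [j' [p' [q' bT]]]]] := ex_bip abC T W.
  apply: (coresolution_cons abC (m := i' ∘ m ∘ p + j' ∘ q) (q := c ∘ p') (Z :=
    Z)) => //; last first.
    exact: (omega_bip bT).
  apply: (short_exact_coker abC) => [V a b|].
    have pm : p' ∘ (i' ∘ m ∘ p + j' ∘ q) = m ∘ p.
      by rewrite compDr !compA (bip_pi bT) (bip_pj bT) comp1m !comp0m addr0.
    have qm : q' ∘ (i' ∘ m ∘ p + j' ∘ q) = q.
      by rewrite compDr !compA (bip_qi bT) (bip_qj bT) comp1m !comp0m add0r.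
    move=> ab; apply: (bip_into bS).
      by apply: (is_kernel_mono mc.1); rewrite !compA -pm -!(compA p') ab.
    by rewrite -qm -!(compA q') ab.
  apply: intro_coker => [|V a b|V h hm].
  - rewrite compDr !compA -[c ∘ p' ∘ i']compA -[c ∘ p' ∘ j']compA.
    by rewrite (bip_pi bT) (bip_pj bT) compm1 mc.2.1 compm0 !comp0m addr0.
  - rewrite !compA => /(congr1 (fun g => g ∘ i')); rewrite -!compA (bip_pi bT).
    by rewrite !compm1 => /(is_coker_epi mc.2).
  have [|u uc] := coker_lift (h := h ∘ i') mc.2.
    move: hm => /(congr1 (fun g => g ∘ i)); rewrite comp0m -compA compDl
      -!compA.
    by rewrite (bip_pi bS) (bip_qi bS) !compm1 compm0 addr0 compA.
  exists u; apply: (bip_outof bT).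
    by rewrite -!compA (bip_pi bT) compm1.
  move: hm => /(congr1 (fun g => g ∘ j)); rewrite comp0m -compA compDl -!compA.
  rewrite (bip_pj bS) (bip_qj bS) (bip_pj bT) !compm0 add0r compm1 => ->.
  by [].
have [K [T [k [e [ke oT pK rK]]]]] := resolution_step abC rX.
have [T' [i' [j' [p' [q' bT]]]]] := ex_bip abC T W.
apply: (resolution_cons abC (k := i' ∘ k) (e := i ∘ e ∘ p' + j ∘ q') (K := K))
  => //; last first.
  exact: (omega_bip bT).
have ei : (i ∘ e ∘ p' + j ∘ q') ∘ i' = i ∘ e.
  by rewrite compDl -!compA (bip_pi bT) (bip_qi bT) !compm1 compm0 addr0.
have ej : (i ∘ e ∘ p' + j ∘ q') ∘ j' = j.
  by rewrite compDl -!compA (bip_pj bT) (bip_qj bT) !compm1 !compm0 add0r.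
apply: (short_exact_kernel abC) => [V a b ab|].
  apply: (bip_outof bS); last by rewrite -ej !compA ab.
  by apply: (is_coker_epi ke.2); rewrite -!compA -ei !compA ab.
apply: intro_kernel => [|V a b|V h eh].
- by rewrite compA ei -compA ke.1.1 compm0.
- rewrite -!compA => /(congr1 (fun g => p' ∘ g)); rewrite !compA (bip_pi bT).
  by rewrite !comp1m => /(is_kernel_mono ke.1).
have [|u ku] := kernel_lift (h := p' ∘ h) ke.1.
  move: eh => /(congr1 (fun g => p ∘ g)); rewrite compm0 compA compDr !compA.
  by rewrite (bip_pi bS) (bip_pj bS) comp1m comp0m addr0 -!compA.
exists u; apply: (bip_into bT); first by rewrite !compA (bip_pi bT) comp1m.
move: eh => /(congr1 (fun g => q ∘ g)); rewrite compm0 compA compDr !compA.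
rewrite (bip_qi bS) (bip_qj bS) (bip_qi bT) !comp0m add0r comp1m => ->.
by [].
Qed.

End CohenMacaulay.

(** * The category of modules is abelian *)

Section LinearKernel.
Variables (R : pzRingType) (M N : lmodType R) (f : {linear M -> N}).

Definition lker_pred : {pred M} := [pred x | f x == 0].

Lemma lker_submod_closed : submod_closed lker_pred.
Proof.
split=> [|a x y]; rewrite !inE ?linear0 //.
by move=> /eqP fx /eqP fy; rewrite linearP fx fy scaler0 addr0.
Qed.

HB.instance Definition _ :=
  GRing.isSubmodClosed.Build R M lker_pred lker_submod_closed.

Record lker := LKer { lker_val : M; lker_valP : lker_val \in lker_pred }.

HB.instance Definition _ := [isSub for lker_val].
HB.instance Definition _ := [Choice of lker by <:].
HB.instance Definition _ := [SubChoice_isSubLmodule of lker by <:].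

End LinearKernel.

Section LinearCokernel.
Variables (R : pzRingType) (M N : lmodType R) (f : {linear M -> N}).

Definition lcoker_rel : rel N := fun x y => `[< exists m, x - y = f m >].

Lemma lcoker_relxx : reflexive lcoker_rel.
Proof. by move=> x; apply/asboolP; exists 0; rewrite subrr linear0. Qed.

Lemma lcoker_rel_sym : symmetric lcoker_rel.
Proof.
suff H x y : lcoker_rel x y -> lcoker_rel y x by move=> x y; apply/idP/idP;
  apply: H.
by move=> /asboolP[m e]; apply/asboolP; exists (- m); rewrite linearN -e opprB.
Qed.

Lemma lcoker_rel_trans : transitive lcoker_rel.
Proof.
move=> y x z /asboolP[m e] /asboolP[m' e']; apply/asboolP; exists (m + m').
by rewrite linearD -e -e' addrA subrK.
Qed.

Canonical lcoker_equiv := EquivRel lcoker_rel lcoker_relxx lcoker_rel_sym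
  lcoker_rel_trans.

Definition lcoker := {eq_quot lcoker_equiv}%qT.
HB.instance Definition _ := EqQuotient.on lcoker.
HB.instance Definition _ := Choice.on lcoker.

Definition lcoker_pi (x : N) : lcoker := (\pi_lcoker x)%qT.

Lemma lcoker_piP x y : lcoker_pi x = lcoker_pi y <-> exists m, x - y = f m.
Proof.
split=> [/eqP|H]; last by apply/eqP; rewrite eqmodE; apply/asboolP.
by rewrite eqmodE => /asboolP.
Qed.

Lemma lcoker_pi_repr (x : lcoker) : lcoker_pi (repr x) = x.
Proof. exact: reprK. Qed.

Definition lcoker_add (x y : lcoker) : lcoker := lcoker_pi (repr x + repr y).
Definition lcoker_opp (x : lcoker) : lcoker := lcoker_pi (- repr x).
Definition lcoker_scale (a : R) (x : lcoker) : lcoker := lcoker_pi (a *: repr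
  x).

Lemma repr_pi x : exists m, repr (lcoker_pi x) - x = f m.
Proof. by apply/lcoker_piP; rewrite lcoker_pi_repr. Qed.

Lemma lcoker_pi_add x y : lcoker_pi (x + y) = lcoker_add (lcoker_pi x)
  (lcoker_pi y).
Proof.
apply/esym/lcoker_piP; have [m e] := repr_pi x; have [m' e'] := repr_pi y.
by exists (m + m'); rewrite linearD -e -e' opprD addrACA.
Qed.

Lemma lcoker_pi_opp x : lcoker_pi (- x) = lcoker_opp (lcoker_pi x).
Proof.
apply/esym/lcoker_piP; have [m e] := repr_pi x.
by exists (- m); rewrite (linearN f) -e opprB opprK addrC.
Qed.

Lemma lcoker_pi_scale a x : lcoker_pi (a *: x) = lcoker_scale a (lcoker_pi x).
Proof.
apply/esym/lcoker_piP; have [m e] := repr_pi x.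
by exists (a *: m); rewrite [f _]linearZ /= -e scalerBr.
Qed.

Let surj (P : lcoker -> Prop) : (forall x, P (lcoker_pi x)) -> forall x, P x.
Proof. by move=> H x; rewrite -(lcoker_pi_repr x). Qed.

Lemma lcoker_addA : associative lcoker_add.
Proof.
by do 3![elim/surj=> ?]; rewrite -!lcoker_pi_add addrA.
Qed.

Lemma lcoker_addC : commutative lcoker_add.
Proof. by do 2![elim/surj=> ?]; rewrite -!lcoker_pi_add addrC. Qed.

Lemma lcoker_add0 : left_id (lcoker_pi 0) lcoker_add.
Proof. by elim/surj=> ?; rewrite -!lcoker_pi_add add0r. Qed.

Lemma lcoker_addN : left_inverse (lcoker_pi 0) lcoker_opp lcoker_add.
Proof. by elim/surj=> ?; rewrite -lcoker_pi_opp -!lcoker_pi_add addNr. Qed.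

HB.instance Definition _ :=
  GRing.isZmodule.Build lcoker lcoker_addA lcoker_addC lcoker_add0 lcoker_addN.

Lemma lcoker_scaleA a b x : lcoker_scale a (lcoker_scale b x) = lcoker_scale (a
  * b) x.
Proof. by elim/surj: x => x; rewrite -!lcoker_pi_scale scalerA. Qed.

Lemma lcoker_scale1 : left_id 1 lcoker_scale.
Proof. by elim/surj=> x; rewrite -!lcoker_pi_scale scale1r. Qed.

Lemma lcoker_scaleDr : right_distributive lcoker_scale +%R.
Proof.
move=> a; do 2![elim/surj=> ?].
by rewrite -[_ + _]lcoker_pi_add -!lcoker_pi_scale scalerDr lcoker_pi_add.
Qed.

Lemma lcoker_scaleDl x : {morph lcoker_scale^~ x : a b / a + b}.
Proof.
elim/surj: x => x a b.
by rewrite -!lcoker_pi_scale scalerDl lcoker_pi_add.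
Qed.

HB.instance Definition _ := GRing.Zmodule_isLmodule.Build R lcoker
  lcoker_scaleA lcoker_scale1 lcoker_scaleDr lcoker_scaleDl.

Lemma lcoker_pi_linear : linear lcoker_pi.
Proof. by move=> a x y; rewrite lcoker_pi_add lcoker_pi_scale. Qed.

HB.instance Definition _ := GRing.isLinear.Build R N lcoker _ lcoker_pi
  lcoker_pi_linear.

End LinearCokernel.

Section LModAbelian.
Variable R : pzRingType.
Implicit Types M N P : LMod R.

Definition lfun M N (f : hom M N) : {linear M -> N} := f.

Lemma lfunP M N (f g : hom M N) : lfun f =1 lfun g -> f = g.
Proof. exact: lin_homP. Qed.

Lemma lfun_comp M N P (g : hom N P) (f : hom M N) x :
  lfun (g ∘ f) x = lfun g (lfun f x).
Proof. by []. Qed.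

Lemma lfunD M N (f g : hom M N) x : lfun (f + g) x = lfun f x + lfun g x.
Proof. by []. Qed.

Lemma lfun0 M N x : lfun (0 : hom M N) x = 0. Proof. by []. Qed.

Lemma lfun_mk M N (f : M -> N) : linear f -> exists g : hom M N, lfun g =1 f.
Proof.
move=> lf; pose m := GRing.isLinear.Build R M N _ f lf.
by exists (HB.pack_for {linear M -> N} f m).
Qed.

(** Injectivity of [f] makes the pointwise choice of preimages linear. *)
Lemma lift_injective M N P (f : hom M N) (h : hom P N) :
  injective (lfun f) -> (forall w, exists x, lfun f x = lfun h w) ->
  exists u, f ∘ u = h.
Proof.
move=> fi /choice[u fu]; have [|g gu] := @lfun_mk P M u.
  by move=> a x y; apply: fi; rewrite linearP !fu linearP.
by exists g; apply: lfunP => x; rewrite lfun_comp gu.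
Qed.

(** Two preimages of an element differ by an element of the kernel of [f], so the value of [h] on a
    chosen preimage is independent of the choice, and hence linear. *)
Lemma lift_surjective M N P (f : hom M N) (h : hom M P) :
  (forall y, exists x, lfun f x = y) ->
  (forall x, lfun f x = 0 -> lfun h x = 0) -> exists u, u ∘ f = h.
Proof.
move=> /choice[s fs] fh.
have hE x y : lfun f x = lfun f y -> lfun h x = lfun h y.
  move=> e; apply/eqP; rewrite -subr_eq0 -linearB; apply/eqP/fh.
  by rewrite linearB /= e subrr.
have [|g gu] := @lfun_mk N P (fun y => lfun h (s y)).
  by move=> a x y; rewrite -linearP; apply: hE; rewrite linearP !fs.
by exists g; apply: lfunP => x; rewrite lfun_comp gu; apply: hE; rewrite fs.
Qed.

(** Tested on the inclusion of the kernel, which [f] sends to zero. *)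
Lemma mono_injective M N (f : hom M N) : mono f -> injective (lfun f).
Proof.
move=> fm; suff H x : lfun f x = 0 -> x = 0.
  move=> x y e; apply/eqP; rewrite -subr_eq0; apply/eqP/H.
  by rewrite linearB /= e subrr.
move=> fx; pose k : hom (lker (lfun f) : LMod R) M :=
  (\val : {linear lker (lfun f) -> M}).
have k0 : k = 0.
  apply: (mono0 fm); apply: lfunP => -[y /= yP].
  by move: yP; rewrite inE => /eqP.
have xP : x \in lker_pred (lfun f) by rewrite inE fx.
by have := congr1 (fun g : hom _ _ => lfun g (LKer xP)) k0.
Qed.

(** Tested on the projection to the cokernel, which vanishes on the image of [f]. *)
Lemma epi_surjective M N (f : hom M N) : epi f -> forall y, exists x, lfun f x
  = y.
Proof.
move=> fe y; pose q : hom N (lcoker (lfun f) : LMod R) :=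
  (@lcoker_pi _ _ _ (lfun f) : {linear N -> lcoker (lfun f)}).
have q0 : q = 0.
  apply: (epi0 fe); apply: lfunP => x.
  by apply/(lcoker_piP (lfun f) (lfun f x) 0); exists x; rewrite subr0.
have : lcoker_pi (lfun f) y = lcoker_pi (lfun f) 0.
  exact: (congr1 (fun g : hom _ _ => lfun g y) q0).
by move=> /lcoker_piP[x]; rewrite subr0 => ->; exists x.
Qed.

Lemma injective_mono M N (f : hom M N) : injective (lfun f) -> mono f.
Proof.
move=> fi P a b ab; apply: lfunP => x; apply: fi.
by rewrite -!lfun_comp ab.
Qed.

Lemma surjective_epi M N (f : hom M N) :
  (forall y, exists x, lfun f x = y) -> epi f.
Proof.
move=> fs P a b ab; apply: lfunP => y; have [x <-] := fs y.
by rewrite -!lfun_comp ab.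
Qed.

Lemma LMod_kernel M N (f : hom M N) : exists (K : LMod R) (k : hom K M),
  is_kernel f k.
Proof.
exists (lker (lfun f) : LMod R), (\val : {linear lker (lfun f) -> M}).
have ki : injective (\val : lker (lfun f) -> M) by exact: val_inj.
apply: intro_kernel => [||P h fh].
- by apply: lfunP => -[y /= yP]; move: yP; rewrite inE => /eqP.
- exact: injective_mono.
apply: lift_injective => // w.
have wP : lfun h w \in lker_pred (lfun f) by rewrite inE -lfun_comp fh.
by exists (LKer wP).
Qed.

Lemma LMod_coker M N (f : hom M N) : exists (Q : LMod R) (q : hom N Q),
  is_coker f q.
Proof.
pose q : hom N (lcoker (lfun f) : LMod R) :=
  (@lcoker_pi _ _ _ (lfun f) : {linear N -> lcoker (lfun f)}).
have qs y : exists x, lfun q x = y by exists (repr y); exact: lcoker_pi_repr.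
exists (lcoker (lfun f) : LMod R), q; apply: intro_coker => [||P h hf].
- apply: lfunP => x.
  by apply/(lcoker_piP (lfun f) (lfun f x) 0); exists x; rewrite subr0.
- exact: surjective_epi.
apply: lift_surjective => // x qx.
have : lcoker_pi (lfun f) x = lcoker_pi (lfun f) 0 by exact: qx.
by move=> /lcoker_piP[m]; rewrite subr0 => ->; rewrite -lfun_comp hf.
Qed.

Lemma LMod_biproduct M N : exists (S : LMod R) (i : hom M S) (j : hom N S)
  (p : hom S M) (q : hom S N), is_biproduct i j p q.
Proof.
have [|i iE] := @lfun_mk M (M * N)%type (fun x => (x, 0)).
  by move=> a x y; congr pair; rewrite /= scaler0 addr0.
have [|j jE] := @lfun_mk N (M * N)%type (fun x => (0, x)).
  by move=> a x y; congr pair; rewrite /= scaler0 addr0.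
have [|p pE] := @lfun_mk (M * N)%type M fst; first by [].
have [|q qE] := @lfun_mk (M * N)%type N snd; first by [].
exists (M * N : lmodType R)%type, i, j, p, q.
split; apply: lfunP => x; rewrite ?lfunD !lfun_comp ?pE ?qE ?iE ?jE //=.
by case: x => x y; congr pair; rewrite /= ?addr0 ?add0r.
Qed.

Lemma LMod_abelian : abelian_category (LMod R).
Proof.
split.
- exact: LMod_biproduct.
- exact: LMod_kernel.
- exact: LMod_coker.
- move=> M N f fm; have fi := mono_injective fm.
  have [Q [q cokq]] := LMod_coker f; exists Q, q.
  apply: intro_kernel => // [|P h qh]; first exact: cokq.1.
  apply: lift_injective => // w.
  pose g : hom N (lcoker (lfun f) : LMod R) :=
    (@lcoker_pi _ _ _ (lfun f) : {linear N -> lcoker (lfun f)}).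
  have [|u uq] := coker_lift (h := g) cokq.
    apply: lfunP => x.
    by apply/(lcoker_piP (lfun f) (lfun f x) 0); exists x; rewrite subr0.
  have : lcoker_pi (lfun f) (lfun h w) = lcoker_pi (lfun f) 0.
    rewrite -[LHS]/(lfun g (lfun h w)) -uq -!lfun_comp -compA qh compm0 lfun0.
    by rewrite -[RHS](linear0 (lfun g)).
  by move=> /lcoker_piP[m]; rewrite subr0 => ->; exists m.
move=> M N f fe; have fs := epi_surjective fe.
have [K [k kerk]] := LMod_kernel f; exists K, k.
apply: intro_coker => // [|P h hk]; first exact: kerk.1.
apply: lift_surjective => // x fx.
pose g : hom (lker (lfun f) : LMod R) M := (\val : {linear lker (lfun f) -> M}).
have [|u ku] := kernel_lift (h := g) kerk.
  by apply: lfunP => -[y /= yP]; move: yP; rewrite inE => /eqP.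
have xP : x \in lker_pred (lfun f) by rewrite inE fx.
by rewrite -[x]/(lfun g (LKer xP)) -ku lfun_comp -lfun_comp hk.
Qed.

End LModAbelian.

(** * Copowers and finitely generated projective modules *)

Section BigComp.
Variable C : preadditive.

Lemma comp_suml (X Y Z : C) n (g : 'I_n -> hom Y Z) (f : hom X Y) :
  (\sum_(i < n) g i) ∘ f = \sum_(i < n) g i ∘ f.
Proof. by apply: (big_morph (fun g => g ∘ f)) => [a b|];
  rewrite ?compDl ?comp0m. Qed.

Lemma comp_sumr (X Y Z : C) n (g : hom Y Z) (f : 'I_n -> hom X Y) :
  g ∘ (\sum_(i < n) f i) = \sum_(i < n) g ∘ f i.
Proof. by apply: (big_morph (fun f => g ∘ f)) => [a b|];
  rewrite ?compDr ?compm0. Qed.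

End BigComp.

Section Copowers.
Variable C : preadditive.
Hypothesis abC : abelian_category C.
Variable T : C.

Lemma ex_copower n : exists (S : C) (i : 'I_n -> hom T S) (p : 'I_n -> hom S T),
  is_copower i p.
Proof.
elim: n => [|n [S [i [p [pi ip]]]]].
  exists zob, (fun=> 0), (fun=> 0); split=> [[]//|].
  exact: to_zob.
have [S' [i' [j' [p' [q' bS]]]]] := ex_bip abC T S.
exists S', (fun a => if unlift ord0 a is Some b then j' ∘ i b else i').
exists (fun a => if unlift ord0 a is Some b then p b ∘ q' else p').
split=> [a b|].
  case: unliftP => [a' ->|->]; case: unliftP => [b' ->|->].
  - by rewrite (inj_eq (lift_inj (h:=ord0))) -pi -compA [q' ∘ _]compA (bip_qj
    bS) comp1m.
  - by rewrite -compA (bip_qi bS) compm0 eq_sym (negPf (neq_lift _ _)).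
  - by rewrite compA (bip_pj bS) comp0m (negPf (neq_lift _ _)).
  - by rewrite eqxx (bip_pi bS).
rewrite big_ord_recl unlift_none; under eq_bigr do rewrite liftK -compA [_ ∘ (_
  ∘ q')]compA.
by rewrite -comp_sumr -comp_suml ip comp1m (bip_id bS).
Qed.

(** A dual basis criterion: a retract of the n-fold copower of T amounts to n morphisms in each
    direction. The complement of such a retract is the kernel of the retraction [c]. *)
Lemma add_subcatP (X : C) : add_subcat T X <->
  exists (n : nat) (x : 'I_n -> hom T X) (y : 'I_n -> hom X T),
    \sum_(k < n) x k ∘ y k = idm X.
Proof.
split=> [[n [S [i [p [[pi ip] [Y [a [b [c [d bS]]]]]]]]]]|[n [x [y xy]]]].
  exists n, (fun k => c ∘ i k), (fun k => p k ∘ a).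
  under eq_bigr do rewrite -compA [_ ∘ (_ ∘ a)]compA.
  by rewrite -comp_sumr -comp_suml ip comp1m (bip_pi bS).
have [S [i [p [pi ip]]]] := ex_copower n.
exists n, S, i, p; split=> //.
pose a := \sum_(k < n) i k ∘ y k; pose c := \sum_(k < n) x k ∘ p k.
have ca : c ∘ a = idm X.
  rewrite comp_suml -xy; apply: eq_bigr => k _; rewrite comp_sumr (bigD1 k) //=.
  rewrite big1 => [|l lk].
    by rewrite -compA [p k ∘ _]compA pi eqxx comp1m addr0.
  by rewrite -compA [p k ∘ _]compA pi eq_sym (negPf lk) comp0m compm0.
have [K [k kerk]] := ex_kernel abC c; have km := is_kernel_mono kerk.
have [|d kd] := kernel_lift (h := idm S - a ∘ c) kerk.
  by rewrite compBr compm1 compA ca comp1m subrr.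
exists K, a, k, c, d; split=> //.
- by apply: km; rewrite compA kd compBl -compA kerk.1 compm0 comp1m compm1
  subr0.
- exact: kerk.1.
- by apply: km; rewrite compA kd compBl -compA ca comp1m compm1 compm0 subrr.
by rewrite kd addrC subrK.
Qed.

Lemma add_subcat_self : add_subcat T T.
Proof.
apply/add_subcatP; exists 1, (fun=> idm T), (fun=> idm T).
by rewrite big_ord1 comp1m.
Qed.

Lemma add_subcat_zob : add_subcat T zob.
Proof.
by apply/add_subcatP; exists 0%N, (fun=> 0), (fun=> 0); apply: to_zob.
Qed.

Lemma add_subcat_bip (X Y S : C) (i : hom X S) (j : hom Y S) (p : hom S X)
    (q : hom S Y) :
  is_biproduct i j p q -> add_subcat T X -> add_subcat T Y -> add_subcat T S.
Proof.
move=> bS /add_subcatP[n [x [y xy]]] /add_subcatP[n' [x' [y' xy']]].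
apply/add_subcatP; exists (n + n')%N.
exists (fun k => match split k with inl l => i ∘ x l | inr l => j ∘ x' l end).
exists (fun k => match split k with inl l => y l ∘ p | inr l => y' l ∘ q end).
rewrite big_split_ord /= -(bip_id bS); congr (_ + _).
  under eq_bigr => k _.
    rewrite (unsplitK (inl k)) -compA [x _ ∘ _]compA.
    over.
  by rewrite -comp_sumr -comp_suml xy comp1m.
under eq_bigr => k _.
  rewrite (unsplitK (inr k)) -compA [x' _ ∘ _]compA.
  over.
by rewrite -comp_sumr -comp_suml xy' comp1m.
Qed.

End Copowers.

Section FGProj.
Variable R : pzRingType.
Implicit Types P : LMod R.

Lemma fgproj_projective P : fgproj P -> projective P.
Proof.
move=> [_ projP] M N g f ge.
have [h gh] := projP M N (lfun g) (epi_surjective ge) (lfun f).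
by exists (h : hom P M); apply: lfunP => x; apply: gh.
Qed.

Lemma fgproj_orth : self_orthogonal (@fgproj R).
Proof.
move=> P P' fP _ [//|n] _; apply/(Ext_vanishesP (LMod_abelian R)).
exact/(ext_null_projective (LMod_abelian R))/fgproj_projective.
Qed.

Lemma fgproj_right_perp P : right_perp (@fgproj R) P.
Proof.
move=> P' fP' [//|n] _; apply/(Ext_vanishesP (LMod_abelian R)).
exact/(ext_null_projective (LMod_abelian R))/fgproj_projective.
Qed.

Lemma fgproj_zob : @fgproj R zob.
Proof.
split.
  exists 0%N, (fun=> 0) => m; exists (fun=> 0); rewrite big_ord0.
  exact: (congr1 (fun f : hom zob zob => lfun f m) (@zobP (LMod R))).
move=> M N g gs f; exists (lfun (0 : @hom (LMod R) zob M)) => x.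
rewrite -[RHS]/(lfun (f : @hom (LMod R) zob N) x) (from_zob (f : @hom (LMod R)
  zob N) 0).
exact: (linear0 g).
Qed.

Lemma fgproj_bip (P P' S : LMod R) (i : hom P S) (j : hom P' S) (p : hom S P)
    (q : hom S P') : is_biproduct i j p q -> fgproj P -> fgproj P' -> fgproj S.
Proof.
move=> bS fP fP'; split.
  have [[n [e eP]] _] := fP; have [[n' [e' eP']] _] := fP'.
  exists (n + n')%N, (fun k => match split k with
    inl l => lfun i (e l) | inr l => lfun j (e' l) end) => m.
  have [c cE] := eP (lfun p m); have [c' cE'] := eP' (lfun q m).
  exists (fun k => match split k with inl l => c l | inr l => c' l end).
  rewrite big_split_ord /=.
  under eq_bigr do rewrite (unsplitK (inl _)) -linearZ.
  under [X in _ + X]eq_bigr do rewrite (unsplitK (inr _)) -linearZ.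
  rewrite -!linear_sum -cE -cE' -!lfun_comp -lfunD.
  by rewrite (bip_id bS).
move=> M N g gs f.
have ge : epi (g : @hom (LMod R) M N) by apply: surjective_epi.
have [h gh] := fgproj_projective fP ((f : @hom (LMod R) S N) ∘ i) ge.
have [h' gh'] := fgproj_projective fP' ((f : @hom (LMod R) S N) ∘ j) ge.
exists (lfun (h ∘ p + h' ∘ q)) => x.
rewrite -[LHS]/(lfun ((g : @hom (LMod R) M N) ∘ (h ∘ p + h' ∘ q)) x).
by rewrite compDr !compA gh gh' -!compA -compDr (bip_id bS) compm1.
Qed.

End FGProj.

(** * The functor Hom(T, -) *)

Section HomFunctor.
Variable A : preadditive.
Hypothesis abA : abelian_category A.
Variable T : A.

Notation R := (endo_op T).
Notation F := (Hom_functor T : functor A (LMod R)).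
Notation omega := (add_subcat T).

Lemma Hom_functorE (X Y : A) (f : hom X Y) (x : hom T X) :
  lfun (fmap F f) (x : hom_from T X) = f ∘ x.
Proof. by []. Qed.

Lemma Hom_functor_add_faithful (W Y : A) (f : hom W Y) : omega W ->
  (forall x : hom T W, f ∘ x = 0) -> f = 0.
Proof.
move=> /(add_subcatP abA)[n [x [y xy]]] f0.
rewrite -(compm1 f) -xy comp_sumr big1 // => k _.
by rewrite compA f0 comp0m.
Qed.

(** Yoneda for summands of copowers: every [z] is the combination of the generators [x k] with
    coefficients [y k ∘ z], scalars acting by precomposition, so linearity determines [g] from its
    values on the [x k]. *)
Lemma Hom_functor_add_full (W Y : A) (g : hom (F W) (F Y)) : omega W ->
  exists f : hom W Y, fmap F f = g.
Proof.
move=> /(add_subcatP abA)[n [x [y xy]]].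
pose gx k : hom T Y := lfun g (x k : hom_from T W).
exists (\sum_(k < n) gx k ∘ y k); apply: lfunP => z.
pose r k : R := y k ∘ (z : hom T W).
have zE : z = \sum_(k < n) r k *: (x k : hom_from T W) :> hom_from T W.
  rewrite -[LHS](comp1m (z : hom T W)) -xy comp_suml.
  by apply: eq_bigr => k _; rewrite -compA.
rewrite {2}zE linear_sum -[LHS]/(_ ∘ (z : hom T W)) comp_suml.
by apply: eq_bigr => k _; rewrite linearZ -compA.
Qed.

Lemma Hom_functor_add_fgproj (W : A) : omega W -> fgproj (F W).
Proof.
move=> /(add_subcatP abA)[n [x [y xy]]].
have zE (z : hom T W) : z = \sum_(k < n)
    ((y k ∘ z : endo T) : R) *: (x k : hom_from T W) :> hom_from T W.
  rewrite -[LHS](comp1m z) -xy comp_suml.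
  by apply: eq_bigr => k _; rewrite -compA.
split.
  exists n, (fun k => x k : hom_from T W) => z.
  by exists (fun k => (y k ∘ (z : hom T W) : endo T)); exact: zE.
move=> M N g gs f.
have /choice[m gm] k := gs (f (x k : hom_from T W)).
pose h (z : hom_from T W) : M :=
  \sum_(k < n) ((y k ∘ (z : hom T W) : endo T) : R) *: m k.
have hl : linear h.
  move=> a u v; rewrite /h scaler_sumr -big_split; apply: eq_bigr => k _ /=.
  rewrite scalerA -scalerDl; congr (_ *: _).
  by rewrite -[LHS]/(y k ∘ ((u : hom T W) ∘ (a : hom T T) + (v : hom T W)))
    compDr compA.
have [h' h'E] := @lfun_mk R (F W) (M : LMod R) h hl.
exists (lfun h') => z /=; rewrite h'E linear_sum {2}(zE z) linear_sum.
by apply: eq_bigr => k _; rewrite !linearZ /= gm.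
Qed.

(** A family of n generators gives a surjection onto P from the image of the n-fold copower of T, a
    free module of rank n; it splits by projectivity. *)
Lemma fgproj_retract (P : LMod R) : fgproj P -> exists (S : A)
  (a : hom P (F S)) (b : hom (F S) P), omega S /\ b ∘ a = idm P.
Proof.
move=> fP; have [[n [e eP]] _] := fP.
have [S [i [p [pi ip]]]] := ex_copower abA T n.
pose h (z : hom_from T S) : P :=
  \sum_(k < n) ((p k ∘ (z : hom T S) : endo T) : R) *: e k.
have hl : linear h.
  move=> a u v; rewrite /h scaler_sumr -big_split; apply: eq_bigr => k _ /=.
  rewrite scalerA -scalerDl; congr (_ *: _).
  by rewrite -[LHS]/(p k ∘ ((u : hom T S) ∘ (a : hom T T) + (v : hom T S)))
    compDr compA.
have [b bE] := @lfun_mk R (F S) P h hl.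
have bs m : exists z, lfun b z = m.
  have [c ->] := eP m.
  exists (\sum_(k < n) i k ∘ (c k : hom T T)).
  rewrite bE; apply: eq_bigr => k _; congr (_ *: _).
  rewrite -[LHS]/(p k ∘ \sum_(k < n) i k ∘ (c k : hom T T)) comp_sumr (bigD1 k)
    //= big1.
    by rewrite compA pi eqxx comp1m addr0.
  by move=> l lk; rewrite compA pi eq_sym (negPf lk) comp0m.
have [a ba] := fgproj_projective fP (idm P) (surjective_epi bs).
exists S, a, b; split=> //; apply/(add_subcatP abA).
by exists n, i, p.
Qed.

(** Pulled back along [t], the sequence becomes an extension of T by K. It splits: since the first
    Ext of T and K vanishes, the identity of K extends to the middle term. The section composed with
    [g'] lifts [t]. *)
Lemma Hom_functor_lift (K E X : A) (k : hom K E) (e : hom E X) :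
  short_exact k e -> right_perp omega K ->
  forall t : hom T X, exists s : hom T E, e ∘ s = t.
Proof.
move=> ke pK t; have ee := is_coker_epi ke.2; have km := is_kernel_mono ke.1.
have [P [g' [f' [fe eg Pinj PP]]]] := pullback_epi abA t ee.
have [|k' [gk' fk']] := PP _ k 0; first by rewrite compm0 ke.1.1.
have k'm : mono k' by move=> V a b ab; apply: km; rewrite -gk' -!compA ab.
have kf : short_exact k' f'.
  apply: (short_exact_kernel abA) => //; apply: intro_kernel => // V h fh.
  have [|u ku] := kernel_lift (h := g' ∘ h) ke.1.
    by rewrite compA eg -compA fh compm0.
  by exists u; apply: Pinj; rewrite compA ?gk' ?fk' ?comp0m.
have ext : ext_null 0 T K.
  by apply/(Ext_vanishesP abA); apply: pK => //; apply: add_subcat_self.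
have [r rk] := ext_null0_extend abA (idm K) kf ext.
have [|s sf] := coker_lift (h := idm P - k' ∘ r) kf.2.
  by rewrite compBl comp1m -compA rk compm1 subrr.
have fs : f' ∘ s = idm T.
  apply: fe; rewrite -compA sf compBr compA fk' comp0m subr0.
  by rewrite compm1 comp1m.
by exists (g' ∘ s); rewrite compA eg -compA fs compm1.
Qed.

Lemma Hom_functor_exact (K E X : A) (k : hom K E) (e : hom E X) :
  short_exact k e -> right_perp omega K -> short_exact (fmap F k) (fmap F e).
Proof.
move=> ke pK; apply: (short_exact_kernel (LMod_abelian R)).
  by apply: surjective_epi => t; apply: (Hom_functor_lift ke pK).
have ki : injective (lfun (fmap F k)) by move=> x y;
  apply: is_kernel_mono ke.1 _ _ _.
apply: intro_kernel => [||P h eh].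
- by rewrite -fmapM ke.1.1 fmap0.
- exact: injective_mono.
apply: lift_injective => // w; apply: (kernel_lift ke.1).
by rewrite -[LHS]/(lfun (fmap F e ∘ h) w) eh.
Qed.

Hypothesis T_orth : self_orthogonal omega.

Let right_perp_res (X : A) : has_resolution omega X -> right_perp omega X :=
  resolution_right_perp abA T_orth (X := X).

Lemma Hom_functor_faithful (X Y : A) (f : hom X Y) : has_resolution omega X ->
  fmap F f = 0 -> f = 0.
Proof.
move=> /(resolution_step abA)[K [W [k [e [ke oW pK _]]]]] f0.
apply: (epi0 (is_coker_epi ke.2)); apply: Hom_functor_add_faithful => // x.
by rewrite -compA -[LHS](Hom_functorE f (e ∘ x)) f0.
Qed.

(** On the first term W of the resolution, fullness on add T lifts [g ∘ fmap F e] to some [h]. The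
    composite [h ∘ k] is killed by F, hence zero because K has a resolution too, so [h] descends to
    X. *)
Lemma Hom_functor_full (X Y : A) (g : hom (F X) (F Y)) : has_resolution omega X
  ->
  exists f, fmap F f = g.
Proof.
move=> /(resolution_step abA)[K [W [k [e [ke oW pK rK]]]]].
have Fke := Hom_functor_exact ke pK.
have [h hE] := Hom_functor_add_full (g ∘ fmap F e) oW.
have [|f fe] := coker_lift (h := h) ke.2.
  apply: (Hom_functor_faithful rK).
  by rewrite fmapM hE -compA Fke.1.1 compm0.
exists f; apply: (is_coker_epi Fke.2).
by rewrite -hE -fmapM fe.
Qed.

(** F sends the first step K → S → Z to a sequence with projective middle term. For [m = 0] a map F
    K → F W comes from K → W by fullness, and that map extends to S since the first Ext of Z and W
    vanishes. Otherwise the degree drops by passing to K, which inherits left orthogonality. *)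
Lemma ext_null_Hom_functor m (Z W : A) : has_resolution omega Z ->
  left_perp omega Z -> omega W -> ext_null m (F Z) (F W).
Proof.
move=> + + oW; elim: m Z => [|m IH] Z rZ pZ;
  have [K [S [k [e [ke oS pK rK]]]]] := resolution_step abA rZ;
  have Fke := Hom_functor_exact ke pK;
  have projS := fgproj_projective (Hom_functor_add_fgproj oS).
  apply: (ext_null0_projective (LMod_abelian R) Fke projS) => g.
  have [f <-] := Hom_functor_full g rK.
  have [|h <-] := ext_null0_extend abA f ke (Y := W).
    by apply/(Ext_vanishesP abA); apply: pZ.
  by exists (fmap F h); rewrite fmapM.
apply: (ext_nullS_projective (LMod_abelian R) Fke projS); apply: IH => //.
exact: (left_perp_kernel abA ke (omega_left_perp T_orth oS) pZ).
Qed.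

Lemma Hom_functor_left_perp (Z : A) : CM omega Z -> left_perp (@fgproj R) (F Z).
Proof.
move=> [cZ rZ] P /fgproj_retract[S [a [b [oS ba]]]] [//|n] _.
apply/(Ext_vanishesP (LMod_abelian R)); apply: (ext_null_retract ba).
apply: ext_null_Hom_functor => //.
exact: (coresolution_left_perp abA T_orth cZ).
Qed.

Lemma Hom_functor_CM (X : A) : CM omega X -> Gproj (F X).
Proof.
move=> cX; split.
  pose Q (M : LMod R) := exists X, CM omega X /\ M = F X.
  apply: (@coresolution_coind _ (LMod_abelian R) (@fgproj R) Q);
    last by exists X.
  move=> _ [Y [cY ->]].
  have [W [Z [m [q [mq oW cZ]]]]] := CM_step abA T_orth cY.
  exists (F W), (F Z), (fmap F m), (fmap F q); split.
  - by apply: Hom_functor_exact => //; apply: right_perp_res; case: cY.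
  - exact: Hom_functor_add_fgproj.
  - exact: Hom_functor_left_perp.
  by exists Z.
(* The predicate is weaker than the one for the coresolution: a syzygy provided by [resolution_step]
   is only known to have a resolution and to be right orthogonal. *)
pose Q (M : LMod R) := exists X, has_resolution omega X /\ M = F X.
apply: (@resolution_coind _ (LMod_abelian R) (@fgproj R) Q); last by exists X;
  case: cX.
move=> _ [Y [/(resolution_step abA)[K [W [k [e [ke oW pK rK]]]]] ->]].
exists (F K), (F W), (fmap F k), (fmap F e); split.
- exact: Hom_functor_exact.
- exact: Hom_functor_add_fgproj.
- exact: fgproj_right_perp.
by exists K.
Qed.

End HomFunctor.

(** * Stable categories *)

Section Stable.
Variable C : preadditive.
Hypothesis abC : abelian_category C.
Variable omega : C -> Prop.
Hypotheses (omega_orth : self_orthogonal omega) (omega_zob : omega zob)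
  (omega_bip : forall (X Y S : C) (i : hom X S) (j : hom Y S) (p : hom S X)
    (q : hom S Y), is_biproduct i j p q -> omega X -> omega Y -> omega S).

Notation steq := (stable_eq omega).

Lemma stable_eq_refl (X Y : C) (f : hom X Y) : steq f f.
Proof. by exists zob, 0, 0; split=> //; rewrite subrr comp0m. Qed.

Lemma stable_eq_sym (X Y : C) (f g : hom X Y) : steq f g -> steq g f.
Proof.
by move=> [W [a [b [oW e]]]]; exists W, (- a), b; split=> //;
  rewrite compmN -e opprB.
Qed.

Lemma stable_eq_trans (X Y : C) (f g h : hom X Y) : steq f g -> steq g h ->
  steq f h.
Proof.
move=> [W [a [b [oW e]]]] [W' [a' [b' [oW' e']]]].
have [S [i [j [p [q bS]]]]] := ex_bip abC W W'.
exists S, (i ∘ a + j ∘ a'), (b ∘ p + b' ∘ q); split;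
  first exact: omega_bip bS _ _.
rewrite compDl !compDr -!compA ![p ∘ (_ ∘ _)]compA ![q ∘ (_ ∘ _)]compA.
rewrite (bip_pi bS) (bip_pj bS) (bip_qi bS) (bip_qj bS).
by rewrite !comp1m !comp0m !compm0 addr0 add0r -e -e' addrA subrK.
Qed.

Lemma stable_eq_compl (X Y Z : C) (h : hom Y Z) (f g : hom X Y) :
  steq f g -> steq (h ∘ f) (h ∘ g).
Proof.
move=> [W [a [b [oW e]]]]; exists W, a, (h ∘ b); split=> //.
by rewrite -compBr e compA.
Qed.

Lemma stable_eq_compr (X Y Z : C) (f g : hom Y Z) (h : hom X Y) :
  steq f g -> steq (f ∘ h) (g ∘ h).
Proof.
move=> [W [a [b [oW e]]]]; exists W, (a ∘ h), b; split=> //.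
by rewrite -compBl e compA.
Qed.

Lemma stable_iso_comp (X Y Z : C) (g : hom Y Z) (f : hom X Y) :
  stable_iso omega g -> stable_iso omega f -> stable_iso omega (g ∘ f).
Proof.
move=> [g' [g'g gg']] [f' [f'f ff']]; exists (f' ∘ g'); split.
  apply: stable_eq_trans f'f; rewrite -compA [g' ∘ _]compA.
  rewrite -[X in steq _ (f' ∘ X)]comp1m.
  exact/stable_eq_compl/stable_eq_compr.
apply: stable_eq_trans gg'; rewrite -compA [f ∘ _]compA.
rewrite -[X in steq _ (g ∘ X)]comp1m.
exact/stable_eq_compl/stable_eq_compr.
Qed.

Lemma stable_iso_bip (X W S : C) (i : hom X S) (j : hom W S) (p : hom S X)
    (q : hom S W) : is_biproduct i j p q -> omega W -> stable_iso omega i.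
Proof.
move=> bS oW; exists p; rewrite (bip_pi bS); split; first exact: stable_eq_refl.
apply: stable_eq_sym; exists W, q, j; split=> //.
by rewrite -(bip_id bS) addrAC subrr add0r.
Qed.

Lemma stable_extend (B E X W : C) (k : hom B E) (e : hom E X) (f : hom B W) :
  short_exact k e -> left_perp omega X -> omega W ->
  exists g : hom E W, g ∘ k = f.
Proof.
move=> ke pX oW; apply: (ext_null0_extend abC f ke).
by apply/(Ext_vanishesP abC); apply: pX.
Qed.

(** [b ∘ a - idm I] kills [i], so it is [r ∘ p] for some [r]; on the cokernels, [g ∘ f - idm S] is
    then [p ∘ r], which factors through I. *)
Lemma comparison_half (X I S J T : C) (i : hom X I) (p : hom I S) (j : hom X J)
    (q : hom J T) (a : hom I J) (b : hom J I) (f : hom S T) (g : hom T S) :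
  short_exact i p -> omega I -> a ∘ i = j -> b ∘ j = i -> f ∘ p = q ∘ a ->
  g ∘ q = p ∘ b -> steq (g ∘ f) (idm S).
Proof.
move=> ip oI ai bj fp gq.
have [|r rp] := coker_lift (h := b ∘ a - idm I) ip.2.
  by rewrite compBl -compA ai bj comp1m subrr.
exists I, r, p; split=> //; apply: (is_coker_epi ip.2).
by rewrite -[RHS]compA rp compBl compBr -compA fp !compA gq comp1m compm1.
Qed.

Lemma comparison_stable_iso (X I S J T : C) (i : hom X I) (p : hom I S)
    (j : hom X J) (q : hom J T) (a : hom I J) (f : hom S T) :
  short_exact i p -> short_exact j q -> omega I -> omega J ->
  left_perp omega T -> a ∘ i = j -> f ∘ p = q ∘ a -> stable_iso omega f.
Proof.
move=> ip jq oI oJ pT ai fp.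
have [b bj] := stable_extend i jq pT oI.
have [|g gq] := coker_lift (h := p ∘ b) jq.2.
  by rewrite -compA bj ip.1.1.
exists g; split; first exact: comparison_half ip oI ai bj fp gq.
exact: comparison_half jq oJ bj ai gq fp.
Qed.

(** Both [a' ∘ h] and [k ∘ a] extend [j' ∘ x] along [i], so they differ by some [r ∘ p]; the two
    maps on cokernels then differ by [q' ∘ r]. *)
Lemma comparison_natural (X I S J T X' I' S' J' T' : C)
    (i : hom X I) (p : hom I S) (j : hom X J) (q : hom J T)
    (i' : hom X' I') (p' : hom I' S') (j' : hom X' J') (q' : hom J' T')
    (a : hom I J) (f : hom S T) (a' : hom I' J') (f' : hom S' T')
    (x : hom X X') (h : hom I I') (s : hom S S') (k : hom J J') (t : hom T T') :
  short_exact i p -> omega J' -> a ∘ i = j -> f ∘ p = q ∘ a ->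
  a' ∘ i' = j' -> f' ∘ p' = q' ∘ a' -> h ∘ i = i' ∘ x -> s ∘ p = p' ∘ h ->
  k ∘ j = j' ∘ x -> t ∘ q = q' ∘ k -> steq (f' ∘ s) (t ∘ f).
Proof.
move=> ip oJ' ai fp ai' fp' hi sp kj tq.
have [|r rp] := coker_lift (h := a' ∘ h - k ∘ a) ip.2.
  by rewrite compBl -!compA hi ai kj compA ai' subrr.
exists J', r, q'; split=> //; apply: (is_coker_epi ip.2).
rewrite -[RHS]compA rp compBl compBr -!compA sp fp !compA fp' tq.
by [].
Qed.

(** The pushout is the cokernel of the map with components [u] and [i], once the sign of [l] is
    changed; this map is mono because its component [i] is. *)
Lemma pushout_short_exact (X I Y Z S : C) (i : hom X I) (u : hom X Y)
    (v : hom Y Z) (l : hom I Z) (a : hom Y S) (b : hom I S) (c : hom S Y)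
    (d : hom S I) :
  mono i -> is_pushout i u v l -> is_biproduct a b c d ->
  short_exact (a ∘ u + b ∘ i) (v ∘ c - l ∘ d).
Proof.
move=> im [li univ] bS; apply: (short_exact_coker abC) => [V x y e|].
  apply: im; have di : d ∘ (a ∘ u + b ∘ i) = i.
    by rewrite compDr !compA (bip_qi bS) (bip_qj bS) comp0m comp1m add0r.
  by rewrite -di -!(compA d) e.
have va : (v ∘ c - l ∘ d) ∘ a = v.
  by rewrite compBl -!compA (bip_pi bS) (bip_qi bS) compm1 compm0 subr0.
have lb : (v ∘ c - l ∘ d) ∘ b = - l.
  by rewrite compBl -!compA (bip_pj bS) (bip_qj bS) compm1 compm0 sub0r.
apply: intro_coker => [|V x y e|V h hk].
- by rewrite compDr !compA va lb compNm li subrr.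
- have xv : x ∘ v = y ∘ v by rewrite -va !compA e.
  have xl : x ∘ l = y ∘ l.
    by apply: oppr_inj; rewrite -!compmN -lb !compA e.
  have [|z [_ zP]] := univ V (x ∘ l) (x ∘ v); first by rewrite -!compA li.
  by rewrite -(zP x) // -(zP y).
have [|z [[zl zv] _]] := univ V (- (h ∘ b)) (h ∘ a).
  apply/eqP; rewrite eq_sym -subr_eq0 compNm opprK -!compA -compDr.
  by rewrite hk.
exists z; apply: (bip_outof bS); rewrite -compA; first by rewrite va.
by rewrite lb compmN zl opprK.
Qed.

End Stable.

(** * The induced functor on stable categories *)

Section HomFunctorStable.
Variable A : preadditive.
Hypothesis abA : abelian_category A.
Variable T : A.

Notation R := (endo_op T).
Notation F := (Hom_functor T : functor A (LMod R)).
Notation omega := (add_subcat T).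
Notation fgp := (@fgproj R).

Hypothesis T_orth : self_orthogonal omega.

Let abR := LMod_abelian R.

Lemma fgproj_CM_left_perp (M : LMod R) : Gproj M -> left_perp fgp M.
Proof. by move=> [cM _]; exact: (coresolution_left_perp abR (@fgproj_orth R)
  cM). Qed.

Lemma Hom_functor_stable_eq (X Y : A) (f g : hom X Y) :
  stable_eq omega f g -> stable_eq fgp (fmap F f) (fmap F g).
Proof.
move=> [W [a [b [oW e]]]]; exists (F W), (fmap F a), (fmap F b).
by split; [exact: Hom_functor_add_fgproj | rewrite -fmapB e fmapM].
Qed.

Lemma Hom_functor_stable_iso (X Y : A) (f : hom X Y) :
  stable_iso omega f -> stable_iso fgp (fmap F f).
Proof.
move=> [g [gf fg]]; exists (fmap F g); rewrite -!fmapM -!fmap1.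
by split; apply: Hom_functor_stable_eq.
Qed.

(** A factorization through P passes through some F S of which P is a retract; both halves lift by
    fullness, and faithfulness on X gives equality of the lifts. *)
Lemma Hom_functor_stably_faithful : stably_faithful F omega fgp.
Proof.
move=> X Y f g [_ rX] _ [P [a [b [fP e]]]].
have [S [c [d [oS dc]]]] := fgproj_retract abA fP.
have [a' a'E] := Hom_functor_full abA (c ∘ a) rX.
have [b' b'E] := Hom_functor_add_full abA (b ∘ d) oS.
exists S, a', b'; split=> //; apply/eqP; rewrite -subr_eq0; apply/eqP.
apply: (Hom_functor_faithful abA rX).
by rewrite !fmapB e fmapM a'E b'E -compA [d ∘ _]compA dc comp1m subrr.
Qed.

Lemma Hom_functor_fully_faithful : fully_faithful_on F (CM omega).
Proof.
move=> X Y [_ rX] _.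
have /choice[G GK] g := Hom_functor_full abA g rX (Y := Y).
exists G => f; last exact: GK.
apply/eqP; rewrite -subr_eq0; apply/eqP/(Hom_functor_faithful abA rX).
by rewrite fmapB GK subrr.
Qed.

Lemma Hom_functor_triangle (S : suspension omega) (S' : suspension fgp) :
  stable_triangle_functor F S S'.
Proof.
have CMF X : CM omega X -> Gproj (F X) := Hom_functor_CM abA T_orth (X := X).
have conf X : CM omega X ->
    short_exact (fmap F (inj_in S X)) (fmap F (susp_proj S X)).
  move=> cX; have [_ _ _ ses] := susp_conflation S cX.
  by apply: Hom_functor_exact => //; apply: resolution_right_perp => //;
    case: cX.
have conf' M : Gproj M -> short_exact (inj_in S' M) (susp_proj S' M).
  by move=> cM; have [] := susp_conflation S' cM.
have pS X : CM omega X -> left_perp fgp (F (susp S X)).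
  move=> cX; apply: fgproj_CM_left_perp; apply: CMF.
  by have [] := susp_conflation S cX.
have pS' M : Gproj M -> left_perp fgp (susp S' M).
  move=> cM; apply: fgproj_CM_left_perp.
  by have [] := susp_conflation S' cM.
(* [phi] compares the image of the conflation chosen for X with the conflation chosen for F X. The
   embedding of F X extends to [eps] because F (Sigma X) is left orthogonal to projectives. Outside
   alpha the value 0 is a default. *)
have H X : exists phi : hom (F (susp S X)) (susp S' (F X)), CM omega X ->
    exists eps : hom (F (inj_obj S X)) (inj_obj S' (F X)),
    eps ∘ fmap F (inj_in S X) = inj_in S' (F X) /\
    phi ∘ fmap F (susp_proj S X) = susp_proj S' (F X) ∘ eps.
  have [cX|ncX] := pselect (CM omega X); last by exists 0.
  have [eps epsE] := stable_extend abR (inj_in S' (F X)) (conf X cX) (pS X cX)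
    (inj_objP S' (CMF X cX)).
  have [|phi phiE] := coker_lift (h := susp_proj S' (F X) ∘ eps) (conf X cX).2.
    by rewrite -compA epsE (conf' _ (CMF X cX)).1.1.
  by exists phi => _; exists eps.
pose phi X := projT1 (cid (H X)); have phiP X := projT2 (cid (H X)).
rewrite -/(phi _) in phiP.
have phi_nat (X Y : A) (f : hom X Y) (f' : hom (susp S X) (susp S Y))
    (g : hom (susp S' (F X)) (susp S' (F Y))) :
    CM omega X -> CM omega Y -> susp_mor f f' -> susp_mor (fmap F f) g ->
    stable_eq fgp (phi Y ∘ fmap F f') (g ∘ phi X).
  move=> cX cY [h [hi hp]] [h' [hi' hp']].
  have [a [ai pa]] := phiP X cX; have [b [bi pb]] := phiP Y cY.
  apply: (comparison_natural (conf X cX) (inj_objP S' (CMF Y cY)) ai pa bi pb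
    (h := fmap F h) _ _ hi' hp'); first by rewrite -!fmapM hi.
  by rewrite -!fmapM hp.
exists phi; split=> //.
  move=> X cX; have [a [ai pa]] := phiP X cX; have cFX := CMF X cX.
  apply: (comparison_stable_iso abR (conf X cX) (conf' _ cFX) _ _ (pS' _ cFX)
    ai pa).
    by apply: (Hom_functor_add_fgproj abA); apply: inj_objP.
  exact: inj_objP.
move=> X Y Z u v w [cX cY cZ [X' [Y' [Z' [u' [v' [w' [std [a [b [c [a'
  iso]]]]]]]]]]]].
have [cX' cY' cZ' [l [po wl wv]]] := std.
have [[sa [sb sc]] sma e1 e2 e3] := iso.
split; try exact: CMF.
have cFX := CMF _ cX; have cFX' := CMF _ cX'.
have [E [iE [jE [pE [qE bE]]]]] := ex_bip abA Y' (inj_obj S X').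
have oI := inj_objP S cX'.
have cE : CM omega E by apply: (CM_bip abA (@add_subcat_bip _ abA T) bE).
have [_ _ _ sesX'] := susp_conflation S cX'.
have kx := pushout_short_exact abA (is_kernel_mono sesX'.1) po bE.
set k := iE ∘ u' + _ in kx; set x := _ - _ in kx.
have Fkx : short_exact (fmap F k) (fmap F x).
  by apply: Hom_functor_exact => //; apply: resolution_right_perp => //;
    case: cX'.
have [eps [epsE phiE]] := phiP X' cX'.
pose I' := inj_obj S' (F X'); have oI' : fgp I' := inj_objP S' cFX'.
have [Z'' [iZ [jZ [pZ [qZ bZ]]]]] := ex_bip abR (F Z') I'.
have [e eE] : exists e : hom (F E) I', e = eps ∘ fmap F qE.
  by exists (eps ∘ fmap F qE).
(* As [e] extends the chosen embedding of F X' along [fmap F k], the pushout of [fmap F k] along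
   that embedding is a split extension of F Z' by I'. *)
have ek : e ∘ fmap F k = inj_in S' (F X').
  rewrite eE -epsE -compA -fmapM; congr (_ ∘ fmap F _).
  by rewrite compDr !compA (bip_qi bE) (bip_qj bE) comp0m comp1m add0r.
have cZ'' : Gproj Z''.
  exact: (CM_bip abR (@fgproj_bip R) bZ (CMF _ cZ') oI').
pose v'' : hom (F E) Z'' := iZ ∘ fmap F x + jZ ∘ e.
(* The sign in [x] gives [w' ∘ x = - (susp_proj S X' ∘ qE)], so the two summands of [w'' ∘ v'']
   cancel. *)
pose w'' : hom Z'' (susp S' (F X')) :=
  phi X' ∘ fmap F w' ∘ pZ + susp_proj S' (F X') ∘ qZ.
have xi : x ∘ iE = v'.
  by rewrite compBl -!compA (bip_pi bE) (bip_qi bE) compm1 compm0 subr0.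
have std'' : standard_triangle (S := S') (fmap F k) v'' w''.
  split=> //; first exact: CMF.
  exists jZ; split.
  - split=> [|V f g fg].
      by rewrite compDl -!compA Fkx.2.1 compm0 add0r ek.
    have [|h hx] := coker_lift (h := g - f ∘ e) Fkx.2.
      by rewrite compBl -compA ek fg subrr.
    exists (h ∘ pZ + f ∘ qZ); split.
      split; rewrite compDl -!compA.
        by rewrite (bip_pj bZ) (bip_qj bZ) compm0 compm1 add0r.
      rewrite !compDr ![pZ ∘ (_ ∘ _)]compA ![qZ ∘ (_ ∘ _)]compA.
      rewrite (bip_pi bZ) (bip_pj bZ) (bip_qi bZ) (bip_qj bZ).
      by rewrite !comp1m !comp0m !compm0 addr0 add0r hx subrK.
    move=> y [yj yv]; apply: (bip_outof bZ); rewrite compDl -!compA.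
      rewrite (bip_pi bZ) (bip_qi bZ) compm1 compm0 addr0.
      apply: (is_coker_epi Fkx.2); rewrite hx -yv -yj.
      by rewrite compDr !compA addrK.
    by rewrite (bip_pj bZ) (bip_qj bZ) compm0 compm1 add0r yj.
  - by rewrite compDl -!compA (bip_pj bZ) (bip_qj bZ) !compm0 compm1 add0r.
  rewrite compDl -!compA !compDr ![pZ ∘ (_ ∘ _)]compA ![qZ ∘ (_ ∘ _)]compA.
  rewrite (bip_pi bZ) (bip_pj bZ) (bip_qi bZ) (bip_qj bZ).
  rewrite !comp1m !comp0m !compm0 addr0 add0r -fmapM compBr !compA wv wl comp0m
    sub0r.
  by rewrite fmapN compmN fmapM compA phiE eE compA addNr.
exists (F X'), (F E), Z'', (fmap F k), v'', w''; split=> //.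
(* A representative [a''] of the suspension of F a is built from the chosen conflations; [phi_nat]
   relates it to [fmap F a']. *)
have [h hE] := stable_extend abR (inj_in S' (F X') ∘ fmap F a) (conf' _ cFX)
  (pS' _ cFX) oI'.
have [|a'' a''E] := coker_lift (h := susp_proj S' (F X') ∘ h) (conf' _ cFX).2.
  by rewrite -compA hE compA (conf' _ cFX').1.1 comp0m.
have sma'' : susp_mor (fmap F a) a'' by exists h.
(* The inclusions [iE] and [iZ] are stable isomorphisms, their complements [inj_obj S X'] and I'
   being in add T and projective. The first square fails to commute strictly only by a map through
   [inj_obj S X']. *)
exists (fmap F a), (fmap F (iE ∘ b)), (iZ ∘ fmap F c), a''.
have zA := add_subcat_zob abA T; have bA := @add_subcat_bip _ abA T.
have zR := @fgproj_zob R; have bR := @fgproj_bip R.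
split=> //.
- split; first exact: Hom_functor_stable_iso.
  split; last first.
    apply: (stable_iso_comp abR bR); last exact: Hom_functor_stable_iso.
    exact: (stable_iso_bip zR bZ oI').
  apply: Hom_functor_stable_iso; apply: (stable_iso_comp abA bA) => //.
  exact: (stable_iso_bip zA bE oI).
- rewrite -!fmapM; apply: Hom_functor_stable_eq.
  apply: (stable_eq_trans abA bA (g := iE ∘ (u' ∘ a))).
    by rewrite -compA; apply: stable_eq_compl.
  apply: stable_eq_sym; exists (inj_obj S X'), (inj_in S X' ∘ a), jE;
    split=> //.
  by rewrite compDl -!compA addrAC subrr add0r.
- rewrite -compA -fmapM.
  have -> : v'' ∘ fmap F (iE ∘ b) = iZ ∘ fmap F (v' ∘ b).
    rewrite compDl eE -!compA -!fmapM !compA xi (bip_qi bE) comp0m fmap0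
      !compm0.
    by rewrite addr0.
  exact/stable_eq_compl/Hom_functor_stable_eq.
have -> : w'' ∘ (iZ ∘ fmap F c) = phi X' ∘ fmap F (w' ∘ c).
  rewrite compDl -!compA [pZ ∘ _]compA [qZ ∘ _]compA (bip_pi bZ) (bip_qi bZ).
  by rewrite comp0m compm0 addr0 comp1m fmapM.
apply: (stable_eq_trans abR bR (g := phi X' ∘ fmap F a' ∘ fmap F w)).
  rewrite compA; apply: stable_eq_compr; apply: stable_eq_sym;
    exact: (phi_nat _ _ _ _ _ cX cX' sma sma'').
rewrite -compA -fmapM; exact/stable_eq_compl/Hom_functor_stable_eq.
Qed.

End HomFunctorStable.

Theorem theorem3p9 (A : preadditive) (abA : abelian_category A)
    (T : A) (T_self_orth : self_orthogonal_object T) :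
  let R := endo_op T in
  let F : functor A (LMod R) := Hom_functor T in
  [/\ restricts_to F (CM (add_subcat T)) (@Gproj R),
      fully_faithful_on F (CM (add_subcat T))
    & induces_full_triangulated_embedding F (add_subcat T) (@fgproj R)].
Proof.
move=> R F.
have CMF : restricts_to F (CM (add_subcat T)) (@Gproj R).
  by move=> X; apply: Hom_functor_CM.
have ff := @Hom_functor_fully_faithful A abA T.
split=> //; split=> //.
- by move=> X Y f g _ _; apply: Hom_functor_stable_eq.
- split; first exact: Hom_functor_stably_faithful.
  move=> X Y g cX cY; have [G _ GK] := ff X Y cX cY.
  by exists (G g); rewrite GK; apply: stable_eq_refl; apply: fgproj_zob.
- split; apply: suspension_inhabited => //.
  + exact: add_subcat_zob.
  + exact: LMod_abelian.
  + exact: fgproj_orth.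
  + exact: fgproj_zob.
by move=> S S'; apply: Hom_functor_triangle.
Qed.
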